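(* Let $\mathbb{F}$ be any field, let $n$ be a prime power, and let $0<\epsilon<0.01$ be an absolute constant. Set $N = n^3$, $r = \frac{1.1\sqrt{n}}{5}$, $k = n-r$, $m = \frac{N}{2}\left(1-\frac{\ln n}{5\sqrt{n}}\right)$, let $d = \Theta(n/\log n)$ be chosen so that $n^{2d} = \frac14 n^{-2}\binom{N-k}{m}/\binom{N-2k}{m-k}$, and let $D = \frac{\epsilon n}{2} + d$. Then any homogeneous $\Sigma\Pi\Sigma\Pi$ circuit over $\mathbb{F}$ computing $NW_{n,D}$ has size at least $n^{\Omega(\sqrt{n})}$.
   Context: Let $\mathbb{F}_n$ be the field with $n$ elements and $\mathbb{F}_{n^2}$ its quadratic extension; identify $[n]$ with $\mathbb{F}_n\subseteq \mathbb{F}_{n^2}$ and $[n^2]$ with $\mathbb{F}_{n^2}$ via fixed bijections. On the $N=n^3$ variables $\{x_{i,j}: i\in[n], j\in[n^2]\}$, the polynomial $NW_{n,D}\in\mathbb{F}[x_{i,j}]$ is $NW_{n,D} = \sum_{f\in \mathbb{F}_{n^2}[z],\ \deg f\le D-1}\ \prod_{i\in[n]} x_{i,f(i)}$. (Integrality of the parameters is assumed as in the source.) A $\Sigma\Pi\Sigma\Pi$ circuit computes $\sum_{i=1}^T\prod_{j=1}^{d_i} Q_{i,j}$ with each $Q_{i,j}$ a sum of monomials; it is homogeneous if every node computes a homogeneous polynomial; size is the number of nodes. *)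

(* Defs.v *)
From HB Require Import structures.
From mathcomp Require Import all_boot all_order all_algebra.
From mathcomp Require Import mpoly.
From mathcomp Require Import reals exp.

Set Implicit Arguments.
Unset Strict Implicit.
Unset Printing Implicit Defensive.

Import Order.TTheory GRing.Theory Num.Theory.
Local Open Scope ring_scope.

Definition prime_power (n : nat) : Prop :=
  exists p e : nat, [/\ prime p, (0 < e)%N & n = (p ^ e)%N].

(* Four-layer circuits (leaves, Pi, Sigma, Pi) with a single Sigma output node.
   The layers form a DAG: a node may feed any number of nodes of the next layer,
   and repeated children are parallel edges.  An edge into a Sigma node carries
   a scalar; unlabelled edges are the case where all these scalars are 1. *)
Record spsp_circuit (F : fieldType) (N : nat) := SPSPCircuit {
  leaves : nat;
  monos : nat;
  sums : nat;
  prods : nat;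
  leaf_label : 'I_leaves -> 'I_N + F;
  mono_children : 'I_monos -> seq 'I_leaves;
  sum_children : 'I_sums -> seq (F * 'I_monos);
  prod_children : 'I_prods -> seq 'I_sums;
  output_children : seq (F * 'I_prods)
}.

Definition leaf_poly (F : fieldType) (N : nat) (C : spsp_circuit F N)
    (i : 'I_(leaves C)) : {mpoly F[N]} :=
  match leaf_label i with inl v => 'X_v | inr c => c%:MP end.

Definition mono_poly (F : fieldType) (N : nat) (C : spsp_circuit F N)
    (i : 'I_(monos C)) : {mpoly F[N]} :=
  \prod_(j <- mono_children i) leaf_poly j.

Definition sum_poly (F : fieldType) (N : nat) (C : spsp_circuit F N)
    (i : 'I_(sums C)) : {mpoly F[N]} :=
  \sum_(e <- sum_children i) e.1 *: mono_poly e.2.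

Definition prod_poly (F : fieldType) (N : nat) (C : spsp_circuit F N)
    (i : 'I_(prods C)) : {mpoly F[N]} :=
  \prod_(j <- prod_children i) sum_poly j.

Definition circuit_poly (F : fieldType) (N : nat) (C : spsp_circuit F N) :
    {mpoly F[N]} :=
  \sum_(e <- output_children C) e.1 *: prod_poly e.2.

Definition homogeneous_circuit (F : fieldType) (N : nat) (C : spsp_circuit F N) :
    Prop :=
  [/\ forall i : 'I_(leaves C), leaf_poly i \is homog mdeg,
      forall i : 'I_(monos C), mono_poly i \is homog mdeg,
      forall i : 'I_(sums C), sum_poly i \is homog mdeg,
      forall i : 'I_(prods C), prod_poly i \is homog mdeg &
      circuit_poly C \is homog mdeg].

Definition circuit_size (F : fieldType) (N : nat) (C : spsp_circuit F N) :
    nat :=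
  (leaves C + monos C + sums C + prods C + 1)%N.

(* K and L play F_n and F_{n^2}, iota the inclusion, phi and psi the
   identifications of [n] with F_n and of F_{n^2} with [n^2].  The variable
   x_{i,j} has index mxvec_index i j, and {poly_D L} consists of the f with
   deg f <= D - 1. *)
Definition NW (F : fieldType) (K L : finFieldType) (iota : {rmorphism K -> L})
    (n : nat) (phi : 'I_n -> K) (psi : L -> 'I_(n ^ 2)) (D : nat) :
    {mpoly F[n * n ^ 2]} :=
  \sum_(f : {poly_D L})
    \prod_(i < n) 'X_(mxvec_index i (psi (f : {poly L}).[iota (phi i)])).

(* z is x when x is an integer, and the floor or the ceiling of x otherwise. *)
Definition rounds (R : realType) (x : R) (z : nat) : Prop := `|z%:R - x| < 1.

(* 1/4 n^{-2} binom(N - k, m) / binom(N - 2 k, m - k), with N = n^3 *)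
Definition d_target (R : realType) (n k m : nat) : R :=
  4^-1 * n%:R ^- 2 *
    ('C(n ^ 3 - k, m)%:R / 'C(n ^ 3 - 2 * k, m - k)%:R).

(* The prescribed real values are never all integers, so each integral
   parameter is an arbitrary integer rounding of its value.  The last-but-one
   clause says that d rounds the solution x of n^{2x} = d_target n k m. *)
Definition nw_parameters (R : realType) (eps : R) (n r k m d D : nat) : Prop :=
  [/\ rounds ((11 / 10) * Num.sqrt (n%:R : R) / 5) r,
      k = (n - r)%N,
      rounds ((n ^ 3)%:R / 2 * (1 - ln (n%:R : R) / (5 * Num.sqrt n%:R))) m,
      d_target R n k m / n%:R ^+ 2 < n%:R ^+ (2 * d)
        /\ n%:R ^+ (2 * d) < d_target R n k m * n%:R ^+ 2 &
      rounds (eps * n%:R / 2 + d%:R) D].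

(* Main.v *)
Require Import Defs.
From HB Require Import structures.
From mathcomp Require Import all_boot all_order all_algebra.
From mathcomp Require Import mpoly.
From mathcomp Require Import reals exp.
From mathcomp Require Import zify ring lra.

Set Implicit Arguments.
Unset Strict Implicit.
Unset Printing Implicit Defensive.

Import Order.TTheory GRing.Theory Num.Theory.
Local Open Scope ring_scope.

(** The measure is the rank of projected shifted partials, read in the quotient
    of the polynomial ring by the squares of the variables: only coefficients of
    multilinear monomials are ever used.  Split the variables into [Y] (the first
    [r ~ sqrt n / 8] rows) and the rest.  The rows of the measure are indexed by a
    monomial [y] of degree [r] in [Y] and a set [U] of [l] variables outside [Y];
    the entry at a set [W] is the coefficient of [y (W \ U)].

    Upper bound.  If every bottom monomial has at most [s] variables, then in a
    product of [n] sums at most [r] factors can contribute [Y]-variables, and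
    modulo squares they contribute degree at most [r s]; so all rows lie in the
    span of few vectors [W |-> avoiding_part J (W \ B)] with [#|J| <= r] and
    [l <= #|B| <= l + r s].

    Lower bound.  Keep each variable with probability [p].  A monomial with more
    than [s] variables survives with probability at most [p ^ (s + 1)].  A set
    [W] is isolated if it contains a surviving codeword [f] such that no other
    surviving codeword with the same [Y]-part avoids [W \ f]; the corresponding
    row is then a unit vector, so the rank is at least the number of isolated
    sets.  A Bonferroni inequality, linear in the survival indicators of pairs of
    codewords, bounds the expected number of isolated sets from below, because
    two distinct polynomials of degree less than [D] agree in few points.

    The density of [W] is chosen so that the ratio of the densities of absent and
    present variables, to the power [n - r], is about [n ^ (2 r)]; then both
    bounds differ by a factor [n ^ (Omega r)].  Of the prescribed parameters only
    [eps n / 2 - 1 <= D <= n / 10] matters, which yields [p <= n ^ (- eps / 2)]. *)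

(** * Multilinear coefficients *)

Section MultilinearCoefficients.
Variables (F : fieldType) (M : nat).
Implicit Types (P Q : {mpoly F[M]}) (A S : {set 'I_M}).

Local Notation "P @[ S ]" := (P@_(mesym1 S)) (at level 2, format "P @[ S ]").

Lemma mesym1_setD A S : A \subset S ->
  mesym1 S = (mesym1 A + mesym1 (S :\: A))%MM.
Proof.
move=> sAS; apply/mnmP=> i; rewrite mnmDE !mnmE inE.
by case: (boolP (i \in A)) => [/(subsetP sAS) ->|].
Qed.

Lemma lepm_mesym1 (m : 'X_{1..M}) S : (m <= mesym1 S)%MM ->
  exists2 A : {set 'I_M}, A \subset S & m = mesym1 A.
Proof.
move=> /mnm_lepP mS; exists [set i | m i != 0%N].
  apply/subsetP=> i; rewrite inE; have := mS i.
  by rewrite mnmE; case: (i \in S) => //; rewrite leqn0 => ->.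
apply/mnmP=> i; rewrite mnmE inE; have := mS i.
by rewrite mnmE; case: (m i) => [|[|k]] //; case: (i \in S).
Qed.

Lemma mcoeffXM_eq0 P (m k : 'X_{1..M}) : ~~ (m <= k)%MM -> ('X_[m] * P)@_k = 0.
Proof.
move=> mk; rewrite mcoeffM big1 // => i /eqP ki; rewrite mcoeffX.
case: eqP => [mi|_]; last by rewrite mul0r.
by case/negP: mk; rewrite ki mi; apply/mnm_lepP=> j; rewrite mnmDE leq_addr.
Qed.

(** Divisors of a squarefree monomial are squarefree, so only multilinear coefficients of the
    factors enter: this is multiplication modulo the squares of the variables. By induction on [P]
    it suffices to treat a single monomial. *)
Lemma mcoeff_mesym1M P Q S :
  (P * Q)@[S] = \sum_(A : {set 'I_M} | A \subset S) P@[A] * Q@[S :\: A].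
Proof.
elim/mpolyind: P => [|c m P _ _ IH].
  by rewrite mul0r mcoeff0 big1 // => A _; rewrite mcoeff0 mul0r.
rewrite mulrDl mcoeffD IH.
under [RHS]eq_bigr do rewrite mcoeffD mulrDl mcoeffZ -mulrA.
rewrite big_split /= -scalerAl mcoeffZ -mulr_sumr; congr (c * _ + _).
have [mS|mS] := boolP (m <= mesym1 S)%MM.
  have [A sAS ->] := lepm_mesym1 mS.
  rewrite (mesym1_setD sAS) mulrC mcoeffMX (bigD1 A) //= mcoeffX eqxx mul1r.
  rewrite big1 ?addr0 // => B /andP[_ nBA]; rewrite mcoeffX.
  by case: eqP => [/inj_mesym1 AB|]; [rewrite AB eqxx in nBA | rewrite mul0r].
rewrite mcoeffXM_eq0 // big1 // => A sAS; rewrite mcoeffX.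
case: eqP => [mA|]; last by rewrite mul0r.
case/negP: mS; rewrite mA; apply/mnm_lepP=> i; rewrite !mnmE.
by case: (boolP (i \in A)) => [/(subsetP sAS) ->|].
Qed.

Lemma mcoeff_mesym1_1 S : (1 : {mpoly F[M]})@[S] = (S == set0)%:R.
Proof. by rewrite mcoeff1 -mesym1_set0 (inj_eq (@inj_mesym1 _)). Qed.

(** A set in the support of the product is a disjoint union of sets from the supports of the
    factors, so both bounds add up. *)
Lemma mcoeff_mesym1_prod_neq0 (I : finType) (J : pred I) (Q : I -> {mpoly F[M]})
    (T : {set 'I_M}) (a b : nat) :
    (forall i, J i -> forall A, (Q i)@[A] != 0 -> (a <= #|A :&: T|)%N /\ (#|A| <= b)%N) ->
  forall S, (\prod_(i | J i) Q i)@[S] != 0 ->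
    (#|J| * a <= #|S :&: T|)%N /\ (#|S| <= #|J| * b)%N.
Proof.
move=> HQ S; rewrite -[#|J|]sum1_card; elim/big_rec2: _ S => [|i k P Ji IH] S.
  rewrite mcoeff_mesym1_1; case: (S =P set0) => [->|_] ; last by rewrite eqxx.
  by rewrite cards0.
move=> nz; have: ~~ [forall (A : {set 'I_M} | A \subset S),
    (Q i)@[A] * P@[S :\: A] == 0].
  apply: contraNN nz => /forall_inP H; rewrite mcoeff_mesym1M big1 // => A sA.
  exact/eqP/H.
rewrite negb_forall_in => /exists_inP[A sA]; rewrite mulf_eq0 negb_or => /andP[h1 h2].
have [l1 u1] := HQ _ Ji _ h1; have [l2 u2] := IH _ h2.
have -> : S = A :|: (S :\: A) by rewrite setDE setUIr setUCr setIT (setUidPr sA).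
have dA : [disjoint A & S :\: A] by rewrite disjoint_sym disjoints_subset setDE subsetIr.
rewrite setIUl !cardsU.
have -> : A :&: T :&: ((S :\: A) :&: T) = set0.
  apply/setP=> x; rewrite !inE; case: (x \in A); rewrite ?andbF //.
have -> : A :&: (S :\: A) = set0 by apply/eqP; rewrite setI_eq0.
by rewrite cards0 !subn0 !mulnDl !mul1n !leq_add.
Qed.

(** The substitution of 0 for the variables outside [V]. It serves as the random restriction and,
    with [~: Y] for [V], to remove the monomials that meet [Y]. *)
Definition restr (V : {set 'I_M}) : {mpoly F[M]} -> {mpoly F[M]} :=
  comp_mpoly [tuple (if i \in V then 'X_i else 0) | i < M].

HB.instance Definition _ V := GRing.LRMorphism.on (restr V).

Lemma restrX V (m : 'X_{1..M}) :
  restr V 'X_[m] = if [set i | m i != 0%N] \subset V then 'X_[m] else 0.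
Proof.
rewrite /restr comp_mpolyX; case: ifPn => [/subsetP sV|/subsetPn[i]].
  rewrite mpolyXE_id; apply: eq_bigr => i _; rewrite tnth_mktuple.
  case: (m i =P 0%N) => [->|/eqP mi]; first by rewrite !expr0.
  by rewrite sV ?inE.
rewrite inE => mi iV; rewrite (bigD1 i) //= tnth_mktuple (negbTE iV).
by rewrite expr0n (negbTE mi) mul0r.
Qed.

Lemma mcoeff_restr V P S : (restr V P)@[S] = if S \subset V then P@[S] else 0.
Proof.
elim/mpolyind: P => [|c m P _ _ IH].
  by rewrite rmorph0 !mcoeff0 if_same.
rewrite linearP /= !mcoeffD IH !mcoeffZ restrX.
case: (m =P mesym1 S) => [->|mS].
  have -> : [set i | (mesym1 S) i != 0%N] = S.
    by apply/setP=> i; rewrite inE mnmE; case: (i \in S).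
  by case: ifP => //; rewrite mcoeff0 mulr0 addr0.
have -> : (if [set i | m i != 0%N] \subset V then 'X_[m] else 0)@[S] = 0 :> F.
  by case: ifP; rewrite ?mcoeff0 // mcoeffX; case: eqP.
by rewrite mcoeffX; case: eqP => // _; rewrite mulr0 !add0r.
Qed.

End MultilinearCoefficients.

(** The hypothesis factors the identity matrix of size [#|A|] through a space of dimension [#|B|].
    This is the only form in which a rank is used. *)
Lemma leq_card_of_unit_combinations (F : fieldType) (T G : finType)
    (A : {set T}) (B : {set G}) (a : T -> G -> F) (e : G -> T -> F) :
    {in A &, forall v w, \sum_(g in B) a v g * e g w = (v == w)%:R} ->
  (#|A| <= #|B|)%N.
Proof.
move=> H.
apply: (@mulmx1_min F _ _ (\matrix_(i, j) a (enum_val i) (enum_val j))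
  (\matrix_(i, j) e (enum_val i) (enum_val j))).
apply/matrixP=> i j; rewrite !mxE.
rewrite -(inj_eq (@enum_val_inj _ _)) -(H _ _ (enum_valP i) (enum_valP j)).
rewrite [RHS]big_enum_val /=; apply: eq_bigr => k _.
by rewrite !mxE.
Qed.

(** * Rows of the measure for a product of polynomials *)

Section RowExpansion.
Variables (F : fieldType) (M : nat).
Implicit Types (A B S U V Y y : {set 'I_M}).

Local Notation "P @[ S ]" := (P@_(mesym1 S)) (at level 2, format "P @[ S ]").

Variables (n : nat) (Q : 'I_n -> {mpoly F[M]}) (Y : {set 'I_M}).

(** The difference keeps, among the multilinear monomials, exactly those with a variable in [Y], so
    each factor indexed by [J] uses at least one such variable. *)
Definition touching_part (J : {set 'I_n}) : {mpoly F[M]} :=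
  \prod_(i in J) (Q i - restr (~: Y) (Q i)).

Definition avoiding_part (J : {set 'I_n}) : {mpoly F[M]} :=
  restr (~: Y) (\prod_(i | i \notin J) Q i).

Lemma prod_touching_avoiding :
  \prod_i Q i = \sum_(J : {set 'I_n}) touching_part J * avoiding_part J.
Proof.
rewrite (eq_bigr (fun i => (Q i - restr (~: Y) (Q i)) + restr (~: Y) (Q i))); last first.
  by move=> i _; rewrite subrK.
rewrite bigA_distr; apply: eq_bigr => J _.
rewrite (bigID (mem J)) /= /touching_part /avoiding_part rmorph_prod.
congr (_ * _); first by apply: eq_bigr => i ->.
by apply: eq_bigr => i /negbTE ->.
Qed.

Variables (r s : nat).
Hypothesis Q_small : forall i A, (Q i)@[A] != 0 -> (#|A| <= s)%N.

Lemma touching_part_neq0 J S : (touching_part J)@[S] != 0 ->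
  (#|J| <= #|S :&: Y|)%N /\ (#|S| <= #|J| * s)%N.
Proof.
move=> nz; rewrite -{1}[#|J|]muln1.
apply: (mcoeff_mesym1_prod_neq0 (J := mem J) _ nz) => i _ A.
rewrite mcoeffB mcoeff_restr; case: ifPn => [_|nA]; first by rewrite subrr eqxx.
rewrite subr0 => /Q_small; split=> //.
case/subsetPn: nA => x xA; rewrite inE negbK => xY.
by rewrite card_gt0; apply/set0Pn; exists x; rewrite inE xA.
Qed.

(** In each summand the first factor depends on the row [(y, U)] only and the second on the column
    [V] only, so all rows lie in the span of vectors indexed by the pairs [(J, B)]. The set [B] is
    [U] together with the variables outside [Y] taken by the touching factors. *)
Lemma mcoeff_row_prod (y U V : {set 'I_M}) :
    y \subset Y -> #|y| = r -> V \subset ~: Y ->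
  (if U \subset V then (\prod_i Q i)@[y :|: (V :\: U)] else 0) =
  \sum_(J : {set 'I_n} | (#|J| <= r)%N)
   \sum_(B in [set B : {set 'I_M} | B \subset ~: Y & (#|U| <= #|B| <= #|U| + r * s)%N])
     (if U \subset B then (touching_part J)@[y :|: (B :\: U)] else 0) *
     (if B \subset V then (avoiding_part J)@[V :\: B] else 0).
Proof.
move=> syY yr sVY; case: ifPn => [sUV|nUV]; last first.
  rewrite big1 // => J _; rewrite big1 // => B _.
  case: ifPn => [sUB|]; last by rewrite mul0r.
  case: ifPn => [sBV|]; last by rewrite mulr0.
  by rewrite (subset_trans sUB sBV) in nUV.
have dis x : x \in y -> x \in V -> false.
  by move=> /(subsetP syY) xY /(subsetP sVY); rewrite inE xY.
rewrite prod_touching_avoiding raddf_sum /= (bigID (fun J : {set 'I_n} => #|J| <= r)%N) /=.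
have yI S : S \subset V -> (y :|: S) :&: Y = y.
  move=> sS; apply/setP=> x; rewrite !inE; case: (boolP (x \in y)) => [/(subsetP syY) ->//|_] /=.
  by apply/negP=> /andP[/(subsetP sS)/(subsetP sVY)]; rewrite inE => /negbTE ->.
(* More than [r] touching factors would need more than [r] variables of [Y], but the monomial has
   only those of [y]. *)
rewrite [X in _ + X]big1 ?addr0; last first.
  move=> J; rewrite -ltnNge => rJ; rewrite mcoeff_mesym1M big1 // => A sA.
  case: (eqVneq (touching_part J)@[A] 0) => [->|/touching_part_neq0[JA _]]; first by rewrite mul0r.
  have : (#|J| <= r)%N.
    rewrite (leq_trans JA) // -yr -(yI (V :\: U)) ?subsetDl //.
    by apply/subset_leq_card/setSI.
  by rewrite leqNgt rJ.
apply: eq_bigr => J Jr; rewrite mcoeff_mesym1M.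
pose h B := y :|: (B :\: U); pose h' A := U :|: (A :\: y).
(* The avoiding part has no variable of [Y], so the touching part must supply all of [y]. The
   remaining sets [A] are then indexed by [B] through [h] and [h']. *)
rewrite (bigID (fun A => y \subset A)) /= [X in _ + X]big1 ?addr0; last first.
  move=> A /andP[sA /subsetPn[x xy xA]].
  rewrite /avoiding_part mcoeff_restr ifN ?mulr0 //.
  by apply/subsetPn; exists x; rewrite !inE ?xA ?xy // (subsetP syY).
rewrite (reindex_onto h h') /=; last first.
  move=> A /andP[sA yA]; apply/setP=> x; rewrite !inE.
  have := subsetP sA x; rewrite !inE; have := subsetP yA x.
  by case: (x \in y); case: (x \in A); case: (x \in U); case: (x \in V) => //=;
    do ?[by move=> /(_ isT) | by move=> _ /(_ isT)].
rewrite [RHS](bigID (fun B => (U \subset B) && (B \subset V))) /=.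
rewrite [X in _ = _ + X]big1 ?addr0; last first.
  move=> B /andP[_]; case: (U \subset B) => //=; last by rewrite mul0r.
  by move=> /negbTE ->; rewrite mulr0.
rewrite big_mkcond [RHS]big_mkcond /=; apply: eq_bigr => B _.
case: (boolP ((U \subset B) && (B \subset V))) => [/andP[sUB sBV]|nB].
  have sB : h B \subset y :|: (V :\: U) by rewrite setUS // setSD.
  have hy : y \subset h B by rewrite subsetUl.
  have hK : h' (h B) == B.
    apply/eqP/setP=> x; rewrite !inE.
    have := subsetP sUB x; have := subsetP sBV x; have := dis x.
    case: (x \in y); case: (x \in B); case: (x \in U); case: (x \in V) => //=;
     do ?[by move=> /(_ isT isT) | by move=> _ /(_ isT) | by move=> _ _ /(_ isT)].
  rewrite sB hy hK /= andbT sUB sBV inE (subset_trans sBV sVY) (subset_leq_card sUB) /=.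
  have -> : (y :|: (V :\: U)) :\: h B = V :\: B.
    apply/setP=> x; rewrite !inE.
    have := subsetP sUB x; have := subsetP sBV x; have := dis x.
    case: (x \in y); case: (x \in B); case: (x \in U); case: (x \in V) => //=;
     do ?[by move=> /(_ isT isT) | by move=> _ /(_ isT) | by move=> _ _ /(_ isT)].
  (* A set [B] with more than [#|U| + r * s] elements contributes 0: at most [r] touching factors
     supply at most [s] variables each. *)
  case: ifPn => // nBs; case: (eqVneq (touching_part J)@[h B] 0) => [->|/touching_part_neq0[_ hs]].
    by rewrite mul0r.
  case/negP: nBs; rewrite -{1}(setIidPr sUB) -[X in (X <= _)%N](cardsID U B) leq_add2l.
  rewrite (leq_trans _ (leq_mul Jr (leqnn s))) // (leq_trans _ hs) //.
  by apply/subset_leq_card/subsetUr.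
rewrite andbF; case: ifPn => // /andP[/andP[sB hy] /eqP hK]; case/negP: nB; rewrite -hK.
apply/andP; split; first exact: subsetUl.
apply/subsetP=> x; rewrite !inE => /orP[/(subsetP sUV)//|/andP[nxy /orP[|/andP[nU xB]]]].
  by rewrite (negbTE nxy).
by have := subsetP sB x; rewrite !inE nU xB /= orbT (negbTE nxy) /= => /(_ isT).
Qed.

End RowExpansion.

(** * Rank upper bound for circuits *)

Section CircuitUpperBound.
Variables (F : fieldType) (M : nat) (C : spsp_circuit F M).

Local Notation "P @[ S ]" := (P@_(mesym1 S)) (at level 2, format "P @[ S ]").

Definition leaf_vars (j : 'I_(leaves C)) : {set 'I_M} :=
  if leaf_label j is inl v then [set v] else set0.

Definition mono_vars (i : 'I_(monos C)) : {set 'I_M} :=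
  \bigcup_(j <- mono_children i) leaf_vars j.

(** If a variable occurs twice among the leaves, all multilinear coefficients vanish; otherwise the
    only candidate is the set of all leaf variables. *)
Lemma mono_poly_neq0 i S : (mono_poly i)@[S] != 0 -> S = mono_vars i.
Proof.
rewrite /mono_poly /mono_vars; elim: (mono_children i) S => [|j l IH] S.
  by rewrite !big_nil mcoeff_mesym1_1; case: (S =P set0) => [-> //|_]; rewrite eqxx.
rewrite !big_cons; apply: contraNeq => nS; rewrite mcoeff_mesym1M big1 // => A sA.
case: (eqVneq (\prod_(j <- l) leaf_poly j)@[S :\: A] 0) => [->|/IH SA]; first by rewrite mulr0.
have -> : (leaf_poly j)@[A] = 0; last by rewrite mul0r.
apply: contraNeq nS => nA; apply/eqP; rewrite -SA.
suff -> : leaf_vars j = A by rewrite setDE setUIr setUCr setIT (setUidPr sA).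
move: nA; rewrite /leaf_poly /leaf_vars; case: (leaf_label j) => [v|c].
  by rewrite mcoeffX -mesym1_set1 (inj_eq (@inj_mesym1 _)); case: (_ =P A) => // _; rewrite eqxx.
by rewrite mcoeffC -mesym1_set0 (inj_eq (@inj_mesym1 _)); case: (A =P set0) => [-> //|_]; rewrite mulr0 eqxx.
Qed.

Lemma restr_sum_poly_small (V : {set 'I_M}) s :
    (forall i, mono_vars i \subset V -> (#|mono_vars i| <= s)%N) ->
  forall (j : 'I_(sums C)) S, (restr V (sum_poly j))@[S] != 0 -> (#|S| <= s)%N.
Proof.
move=> small j S; apply: contraNleq => Ss; rewrite mcoeff_restr; case: ifP => // sSV.
rewrite /sum_poly raddf_sum /= big1 // => e _; rewrite mcoeffZ.
case: (eqVneq (mono_poly e.2)@[S] 0) => [->|/mono_poly_neq0 SE]; first by rewrite mulr0.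
by move: Ss; rewrite SE ltnNge small // -SE.
Qed.

(** Constant factors are moved into [c]; each remaining factor adds at least one to the degree.
    Since [msize] is the degree plus one, the strict inequality bounds the number of factors by the
    degree. *)
Lemma prod_sum_poly_normal (l : seq 'I_(sums C)) :
    \prod_(j <- l) sum_poly j != 0 ->
  exists c : F, exists2 l' : seq 'I_(sums C),
    (size l' < msize (\prod_(j <- l) sum_poly j))%N &
    \prod_(j <- l) sum_poly j = c *: \prod_(j <- l') sum_poly j.
Proof.
elim: l => [|j l IH] nz.
  exists 1; exists [::]; last by rewrite scale1r.
  by rewrite big_nil msize1.
move: nz; rewrite !big_cons mulf_eq0 negb_or => /andP[nj nl].
have [c [l' sl El]] := IH nl.
rewrite msizeM //; case: (leqP (msize (sum_poly j)) 1) => [/msize1_polyC sj|sj].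
  exists ((sum_poly j)@_0 * c); exists l'.
    by rewrite sj in nj *; move: nj; rewrite msizeC mpolyC_eq0 => ->.
  by rewrite {1}sj El mul_mpolyC scalerA.
exists c; exists (j :: l'); last by rewrite big_cons El scalerAr.
by move: sj sl; case: (msize (sum_poly j)) => [|[|a]] //= _ sl; rewrite ltnS (leq_trans sl) // leq_addl.
Qed.

(** Homogeneity enters here: one nonzero multilinear coefficient of degree [n] forces the whole
    product to have degree [n], hence at most [n] nonconstant factors. If there is no such
    coefficient, [c = 0] works. *)
Lemma prod_poly_normal n (e : 'I_(prods C)) : prod_poly e \is homog mdeg ->
  exists c : F, exists Q : 'I_n -> {mpoly F[M]},
    (forall S : {set 'I_M}, #|S| = n -> (prod_poly e)@[S] = c * (\prod_i Q i)@[S]) /\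
    (forall i, Q i = 1 \/ exists j : 'I_(sums C), Q i = sum_poly j).
Proof.
move=> hom; have [/existsP[S /andP[/eqP Sn nz]]|none] :=
    boolP [exists S : {set 'I_M}, (#|S| == n) && ((prod_poly e)@[S] != 0)]; last first.
  exists 0, (fun=> 1); split=> [S Sn|i]; last by left.
  rewrite mul0r; apply/eqP; apply: contraNT none => nz.
  by apply/existsP; exists S; rewrite Sn eqxx.
have nz0 : prod_poly e != 0 by apply: contraNneq nz => ->; rewrite mcoeff0.
have [c [l sl El]] := prod_sum_poly_normal nz0.
have sz : msize (prod_poly e) = n.+1.
  move: hom; rewrite homog_msize => /dhomogP /(_ (mesym1 S)).
  rewrite mcoeff_msupp nz /= mdeg_mesym1 Sn => /(_ isT) ->.
  by rewrite prednK // lt0n msize_poly_eq0.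
(* The default value 1 of [nth] pads the product to exactly [n] factors. *)
exists c, (fun i => nth 1 [seq sum_poly j | j <- l] i); split; last first.
  move=> i; case: (ltnP i (size l)) => [il|?]; last by left; rewrite nth_default ?size_map.
  have j0 : 'I_(sums C) by case: (l) il => // j.
  by right; exists (nth j0 l i); rewrite (nth_map j0).
move=> T _; rewrite {1}/prod_poly El mcoeffZ; congr (c * _@[_]).
move: sl; rewrite [msize _]sz ltnS => sl.
rewrite -(big_mkord xpredT (fun i => nth 1 [seq sum_poly j | j <- l] i)).
rewrite (big_cat_nat (n := size l)) //= [X in _ * X]big_nat_cond [X in _ * X]big1 ?mulr1; last first.
  by move=> i /andP[/andP[li _] _]; rewrite nth_default ?size_map.
by rewrite -(size_map (@sum_poly F M C) l) -(big_nth 1 xpredT id) big_map.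
Qed.

(** Parallel edges into the output are merged, so that later bounds count product nodes rather than
    edges. *)
Lemma circuit_poly_prods :
  exists w : 'I_(prods C) -> F, circuit_poly C = \sum_e w e *: prod_poly e.
Proof.
exists (fun e => \sum_(x <- output_children C | x.2 == e) x.1).
under eq_bigr do rewrite scaler_suml.
rewrite (exchange_big_dep xpredT) //= /circuit_poly; apply: eq_bigr => x _.
by rewrite (big_pred1 x.2) // => e; rewrite eq_sym.
Qed.

(** On the columns [cols], the rows [(y W, U W)] form an identity matrix, while each row is a
    combination of vectors indexed by a product node, a set [J] and a set [B]. The right side counts
    these triples. *)
Lemma leq_card_isolated_columns (V Y : {set 'I_M}) (n r s l : nat)
    (cols : {set {set 'I_M}}) (y U : {set 'I_M} -> {set 'I_M}) :
    homogeneous_circuit C ->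
    (forall i, mono_vars i \subset V -> (#|mono_vars i| <= s)%N) ->
    {in cols, forall W : {set 'I_M}, [/\ W \subset ~: Y, (r + #|W| = n + l)%N,
       y W \subset Y, #|y W| = r & #|U W| = l]} ->
    {in cols &, forall W W' : {set 'I_M}, (if U W \subset W' then
       (restr V (circuit_poly C))@[y W :|: (W' :\: U W)] else 0) = (W == W')%:R} ->
  (#|cols| <= prods C * #|[set J : {set 'I_n} | (#|J| <= r)%N]| *
     #|[set B : {set 'I_M} | B \subset ~: Y & (l <= #|B| <= l + r * s)%N]|)%N.
Proof.
move=> [_ _ _ hom _] small colsP unit.
have [w Ew] := circuit_poly_prods.
have /fin_all_exists[c /fin_all_exists[Q QP]] := fun e => prod_poly_normal n (hom e).
pose Qr e i := restr V (Q e i).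
have Qsmall e i A : (Qr e i)@[A] != 0 -> (#|A| <= s)%N.
  rewrite /Qr; case: ((QP e).2 i) => [->|[j ->]]; last exact: restr_sum_poly_small.
  by rewrite rmorph1 mcoeff_mesym1_1; case: (A =P set0) => [->|_]; [rewrite cards0 | rewrite eqxx].
set JJ := [set J | _]; set BB := [set B | _].
rewrite -[prods C]card_ord -cardsT -!cardsX.
pose a W (g : 'I_(prods C) * {set 'I_n} * {set 'I_M}) : F :=
  w g.1.1 * c g.1.1 * (if U W \subset g.2 then
     (touching_part (Qr g.1.1) Y g.1.2)@[y W :|: (g.2 :\: U W)] else 0).
pose b (g : 'I_(prods C) * {set 'I_n} * {set 'I_M}) (W : {set 'I_M}) : F :=
  if g.2 \subset W then (avoiding_part (Qr g.1.1) Y g.1.2)@[W :\: g.2] else 0.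
apply: (@leq_card_of_unit_combinations F _ _ _ _ a b) => W W' hW hW'.
rewrite -unit //; have [sWY cW syY yr Ul] := colsP _ hW.
have [sWY' cW' _ _ _] := colsP _ hW'.
transitivity (\sum_e w e * c e * (if U W \subset W' then
    (\prod_i Qr e i)@[y W :|: (W' :\: U W)] else 0)).
  under [RHS]eq_bigr do rewrite (mcoeff_row_prod (@Qsmall _) _ syY yr sWY') Ul mulr_sumr.
  rewrite pair_big_dep /=.
  under [RHS]eq_bigr do rewrite mulr_sumr.
  rewrite pair_big_dep /=; apply: eq_big => [[[e J] B]|[[e J] B] _] /=.
    by rewrite !inE.
  by rewrite /a /b /= mulrA.
case: ifPn => [sUW|_]; last by rewrite big1 // => e _; rewrite mulr0.
rewrite Ew mcoeff_restr raddf_sum /=.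
transitivity (\sum_e w e * (if y W :|: (W' :\: U W) \subset V then
   (prod_poly e)@[y W :|: (W' :\: U W)] else 0)); last first.
  case: ifP => _; last by rewrite big1 // => e _; rewrite mulr0.
  by apply: eq_bigr => e _; rewrite mcoeffZ.
apply: eq_bigr => e _.
rewrite /Qr -rmorph_prod mcoeff_restr; case: ifPn => _; last by rewrite !mulr0.
(* The coefficient has degree [r + #|W'| - l = n], the degree in which the normal form of
   [prod_poly e] holds. *)
rewrite (QP e).1 ?mulrA // cardsU (cardsD W') (setIidPr sUW) yr Ul.
have -> : y W :&: (W' :\: U W) = set0.
  apply/setP=> x; rewrite !inE; apply/negP => /andP[/(subsetP syY) xY /andP[_ /(subsetP sWY')]].
  by rewrite inE xY.
rewrite cards0 subn0; apply/eqP; rewrite -(eqn_add2r l) -addnA subnK ?cW' //.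
by rewrite -Ul subset_leq_card.
Qed.

End CircuitUpperBound.

(** * Random restrictions and binomial estimates *)

Section RandomSubset.
Variables (R : realFieldType) (T : finType) (p : R).
Implicit Types (S V : {set T}).

(** The probability of [V] when each element is kept independently with probability [p]. *)
Definition bernoulli_weight (V : {set T}) : R :=
  \prod_(x : T) (if x \in V then p else 1 - p).

(** Expand the product of the factors [p + (1 - p)], in which [1 - p] is replaced by 0 at the
    elements of [S]. *)
Lemma sum_bernoulli_weight_superset (S : {set T}) :
  \sum_(V : {set T}) bernoulli_weight V * (S \subset V)%:R = p ^+ #|S|.
Proof.
transitivity (\prod_(x : T) (p + (if x \in S then 0 else 1 - p))).
  rewrite bigA_distr; apply: eq_big => [V|V _]; first by rewrite inE.
  rewrite /bernoulli_weight; case: (boolP (S \subset V)) => [/subsetP sV|/subsetPn[x xS xV]].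
    rewrite mulr1; apply: eq_bigr => x _; case: ifPn => // xV.
    by case: ifPn => // /sV; rewrite (negbTE xV).
  rewrite mulr0; apply/esym/eqP/prodf_eq0; exists x => //.
  by rewrite (negbTE xV) xS.
rewrite (bigID (mem S)) /= [X in _ * X]big1 ?mulr1; last first.
  by move=> x /negbTE ->; rewrite addrC subrK.
by rewrite (eq_bigr (fun=> p)) ?prodr_const // => x ->; rewrite addr0.
Qed.

Lemma sum_bernoulli_weight : \sum_(V : {set T}) bernoulli_weight V = 1.
Proof.
rewrite -[RHS](expr0 p) -(cards0 T) -sum_bernoulli_weight_superset.
by apply: eq_bigr => V _; rewrite sub0set mulr1.
Qed.

Hypothesis p01 : 0 <= p <= 1.

Lemma bernoulli_weight_ge0 V : 0 <= bernoulli_weight V.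
Proof.
by apply: prodr_ge0 => x _; case/andP: p01 => p0 p1; case: ifP; rewrite ?subr_ge0.
Qed.

Lemma exists_ge_expectation (g : {set T} -> R) (c : R) :
    c <= \sum_(V : {set T}) bernoulli_weight V * g V ->
  exists V, c <= g V.
Proof.
move=> cE; have [/existsP[V]|/existsPn none] := boolP [exists V, c <= g V]; first by exists V.
suff : \sum_(V : {set T}) bernoulli_weight V * g V < c by rewrite ltNge cE.
rewrite -[ltRHS]mul1r -sum_bernoulli_weight mulr_suml.
have /existsP[V0 w0] : [exists V : {set T}, 0 < bernoulli_weight V].
  apply/contraT => /existsPn w0; have := sum_bernoulli_weight.
  rewrite big1 => [/esym/eqP|V _]; first by rewrite oner_eq0.
  by apply/eqP; rewrite eq_le bernoulli_weight_ge0 andbT leNgt w0.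
rewrite (bigD1 V0) //= [ltRHS](bigD1 V0) //= ltr_leD //.
  by rewrite ltr_pM2l // ltNge none.
by apply: ler_sum => V _; rewrite ler_wpM2l ?bernoulli_weight_ge0 // ltW // ltNge none.
Qed.

End RandomSubset.

Lemma card_draws_between (T : finType) (A B E : {set T}) t :
    A \subset E -> B \subset E -> [disjoint A & B] ->
  #|[set V : {set T} | [&& V \subset E, A \subset V, [disjoint V & B] & #|V| == (#|A| + t)%N]]|
    = 'C(#|E| - #|A| - #|B|, t).
Proof.
move=> sAE sBE dAB.
have cE : #|E :\: (A :|: B)| = (#|E| - #|A| - #|B|)%N.
  rewrite cardsD (setIidPr _) ?subUset ?sAE // cardsU.
  by rewrite (eqP (_ : A :&: B == set0)) ?cards0 ?subn0 ?setI_eq0 // subnDA.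
rewrite -cE -cards_draws; set S1 := [set V | _]; set S2 := [set A0 | _].
have -> : S1 = [set A :|: U | U in S2].
  apply/setP=> V; apply/idP/imsetP; rewrite inE.
    case/and4P=> VE AV dVB /eqP cV; exists (V :\: A); last first.
      by rewrite setDE setUIr setUCr setIT (setUidPr AV).
    rewrite inE cardsD (setIidPr AV) cV addKn eqxx andbT.
    apply/subsetP=> x; rewrite !inE => /andP[nA xV]; rewrite (negbTE nA) (subsetP VE) //= andbT.
    by rewrite (disjointFr dVB).
  case=> U; rewrite inE => /andP[/subsetP sU /eqP cU] ->.
  have dAU : A :&: U = set0.
    apply/setP=> x; rewrite !inE; apply/negP=> /andP[xA /sU]; by rewrite !inE xA.
  rewrite subUset sAE subsetUl cardsU dAU cards0 subn0 cU eqxx !andbT /=.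
  apply/andP; split; first by apply/subsetP=> x /sU; rewrite !inE => /andP[].
  rewrite disjoints_subset subUset -disjoints_subset dAB.
  by apply/subsetP=> x /sU; rewrite !inE negb_or => /andP[/andP[]].
apply: card_in_imset => U1 U2; rewrite !inE => /andP[/subsetP s1 _] /andP[/subsetP s2 _] /setP eU.
apply/setP=> x; have := eU x; have := s1 x; have := s2 x; rewrite !inE.
by case: (x \in U1); case: (x \in U2); case: (x \in A) => //= h1 h2; do ?[by have := h1 isT | by have := h2 isT].
Qed.

(** * Ratios of binomial coefficients *)

Section BinomialRatios.
Variable R : realFieldType.

(** The quotient is a product of the [j] factors [(b - i) / (a - i)], each at most [b / a]. *)
Lemma bin_sub_both_le (a b j : nat) : (j <= b)%N -> (b <= a)%N -> (0 < a)%N ->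
  'C(a - j, b - j)%:R <= (b%:R / a%:R) ^+ j * 'C(a, b)%:R :> R.
Proof.
move=> jb ba a0; elim: j jb => [|j IH] jb; first by rewrite !subn0 expr0 mul1r.
have aj : (0 < a - j)%N by rewrite subn_gt0 (leq_trans jb).
rewrite exprS -mulrA; apply: le_trans (ler_wpM2l _ (IH (ltnW jb))); last by rewrite divr_ge0.
rewrite mulrAC ler_pdivlMr ?ltr0n // -!natrM ler_nat.
have := mul_bin_diag (a - j) (b - j).-1.
rewrite prednK ?subn_gt0 // -!subnS => E.
rewrite -(leq_pmul2l aj) mulnA E mulnAC mulnA leq_mul //.
by rewrite mulnBl mulnBl mulnC leq_sub2l // leq_mul2l ba orbT.
Qed.

Lemma bin_sub_top_le (a b j : nat) : (b <= a)%N -> (0 < a)%N ->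
  'C(a - j, b)%:R <= ((a - b)%:R / a%:R) ^+ j * 'C(a, b)%:R :> R.
Proof.
move=> ba a0; elim: j => [|j IH]; first by rewrite subn0 expr0 mul1r.
rewrite exprS -mulrA; apply: le_trans (ler_wpM2l _ IH); last by rewrite divr_ge0.
rewrite mulrAC ler_pdivlMr ?ltr0n // -!natrM ler_nat.
(* For [a <= j] truncated subtraction makes both tops 0. *)
have [aj|aj] := leqP a j.
  have [-> ->] : (a - j = 0 /\ a - j.+1 = 0)%N by lia.
  rewrite mulnC leq_mul2r bin0n.
  by case: (b) => [|b'] //=; rewrite subn0.
have aj0 : (0 < a - j)%N by rewrite subn_gt0.
have := mul_bin_down (a - j) b; rewrite -subnS => E.
rewrite -(leq_pmul2l aj0) mulnA E mulnAC mulnA leq_mul //.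
have [abj|abj] := leqP (a - j) b; first by rewrite (eqP (_ : (_ - b == 0)%N)) // subn_eq0.
have [c Ec] : exists c, (a = c + b + j)%N by exists (a - j - b)%N; lia.
have -> : (a - j - b = c)%N by lia.
have -> : (a - j = c + b)%N by lia.
have -> : (a - b = c + j)%N by lia.
by rewrite Ec !mulnDl !mulnDr; lia.
Qed.

End BinomialRatios.

(** * Isolated columns of a code *)

Section Codes.
Variables (n m r : nat) (Phi : finType) (code : Phi -> 'I_n -> 'I_m).
Hypothesis r_le_n : (r <= n)%N.
Implicit Types (f g : Phi) (V W A : {set 'I_(n * m)}).

Definition word f : {set 'I_(n * m)} := [set mxvec_index i (code f i) | i : 'I_n].

(** This is the set [Y] of the measure. *)
Definition low_rows : {set 'I_(n * m)} :=
  [set mxvec_index i j | i in [set i : 'I_n | (i < r)%N], j in [set: 'I_m]].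

Definition high_part f : {set 'I_(n * m)} := word f :\: low_rows.

Definition differ f g : {set 'I_n} := [set i | code g i != code f i].

Lemma mxvec_index_inj (i i' : 'I_n) (j j' : 'I_m) :
  mxvec_index i j = mxvec_index i' j' -> (i, j) = (i', j').
Proof. by move=> /cast_ord_inj/enum_rank_inj. Qed.

Lemma in_word f i j : (mxvec_index i j \in word f) = (code f i == j).
Proof.
apply/imsetP/eqP => [[i' _ /mxvec_index_inj[-> ->]]|<-] //.
by exists i.
Qed.

Lemma in_low_rows i j : (mxvec_index i j \in low_rows) = (i < r)%N.
Proof.
apply/imset2P/idP => [[i' j']|ir]; first by rewrite inE => ir _ /mxvec_index_inj[->].
by exists i j; rewrite ?inE.
Qed.

Lemma in_high_part f i j :
  (mxvec_index i j \in high_part f) = (r <= i)%N && (code f i == j).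
Proof. by rewrite inE in_low_rows in_word -leqNgt. Qed.

Lemma card_word_rows f (A : {set 'I_n}) :
  #|[set mxvec_index i (code f i) | i in A]| = #|A|.
Proof. by apply: card_imset => i i' /mxvec_index_inj[]. Qed.

Lemma card_word f : #|word f| = n.
Proof. by rewrite card_imset ?card_ord // => i i' /mxvec_index_inj[]. Qed.

Lemma card_low_ord : #|[set i : 'I_n | (i < r)%N]| = r.
Proof.
have inj : injective (widen_ord r_le_n) by move=> i j /(congr1 val) /= /val_inj.
rewrite -[RHS]card_ord -(card_imset _ inj).
apply: eq_card => i; rewrite inE; apply/idP/imsetP => [ir|[j _ ->]]; last by rewrite /= ltn_ord.
by exists (Ordinal ir) => //; apply: val_inj.
Qed.

Lemma card_high_ord : #|[set i : 'I_n | (r <= i)%N]| = (n - r)%N.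
Proof.
have -> : [set i : 'I_n | (r <= i)%N] = ~: [set i : 'I_n | (i < r)%N].
  by apply/setP=> i; rewrite !inE -leqNgt.
by rewrite -[X in (X - _)%N](card_ord n) -(cardsC [set i : 'I_n | (i < r)%N]) card_low_ord addKn.
Qed.

Lemma card_high_part f : #|high_part f| = (n - r)%N.
Proof.
rewrite -card_high_ord -(card_word_rows f); apply: eq_card => x.
case/mxvec_indexP: x => i j; rewrite in_high_part; apply/andP/imsetP.
  by case=> ri /eqP <-; exists i; rewrite ?inE.
by case=> i'; rewrite inE => ri' /mxvec_index_inj[-> ->].
Qed.

Lemma card_low_part f : #|word f :&: low_rows| = r.
Proof.
have := cardsID low_rows (word f); rewrite card_word [#|_ :\: _|]card_high_part.
by lia.
Qed.

Lemma card_high_rows : #|~: low_rows| = ((n - r) * m)%N.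
Proof.
rewrite -card_high_ord -[m in RHS]card_ord -cardsT -cardsX.
pose h (u : 'I_n * 'I_m) := mxvec_index u.1 u.2.
rewrite -(card_imset _ (_ : injective h)); last first.
  by case=> i j [i' j'] /mxvec_index_inj.
apply: eq_card => x; case/mxvec_indexP: x => i j; rewrite inE in_low_rows -leqNgt.
apply/idP/imsetP => [ri|[[i' j']]]; first by exists (i, j); rewrite // !inE ri.
by rewrite !inE andbT => ri /mxvec_index_inj[-> _].
Qed.

Lemma card_wordD f g : #|word g :\: word f| = #|differ f g|.
Proof.
rewrite -(card_word_rows g); apply: eq_card => x; case/mxvec_indexP: x => i j.
rewrite inE !in_word; apply/andP/imsetP.
  by case=> fi /eqP gj; exists i; rewrite ?gj // inE gj eq_sym.
by case=> i'; rewrite inE => d /mxvec_index_inj[-> ->]; rewrite eq_sym eqxx.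
Qed.

Lemma card_wordU f g : #|word f :|: word g| = (n + #|differ f g|)%N.
Proof.
rewrite -card_wordD -[X in _ = (X + _)%N](card_word f).
have -> : word f :|: word g = word f :|: (word g :\: word f).
  by apply/setP=> x; rewrite !inE; case: (_ \in _).
rewrite cardsU (_ : _ :&: _ = set0) ?cards0 ?subn0 //.
by apply/setP=> x; rewrite !inE; case: (_ \in _).
Qed.

Lemma card_high_partD f g :
  #|high_part g :\: high_part f| = #|[set i in differ f g | (r <= i)%N]|.
Proof.
rewrite -(card_word_rows g); apply: eq_card => x; case/mxvec_indexP: x => i j.
rewrite inE !in_high_part; apply/idP/imsetP.
  case/andP=> + /andP[ri /eqP gj]; rewrite ri /= => fi.
  by exists i; rewrite ?gj // !inE ri andbT gj eq_sym.
by case=> i'; rewrite !inE => /andP[d ri] /mxvec_index_inj[-> ->]; rewrite ri /= eq_sym d eqxx.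
Qed.

Lemma eq_low_part_differ f g i :
  word g :&: low_rows = word f :&: low_rows -> i \in differ f g -> (r <= i)%N.
Proof.
move=> /setP/(_ (mxvec_index i (code g i))); rewrite !inE !in_word in_low_rows eqxx /=.
by case: (leqP r i) => // _; case: (code f i =P code g i) => [->|//]; rewrite eqxx.
Qed.

(** The set [W] has room for the [n - r] high variables of a codeword and [l] further ones. Only
    words [g] with the low part of [f] compete, because the row attached to [f] fixes that low
    part. *)
Definition isolated (V : {set 'I_(n * m)}) (l : nat) : {set {set 'I_(n * m)}} :=
  [set W : {set 'I_(n * m)} | [&& W \subset ~: low_rows, #|W| == (n - r + l)%N &
    [exists f, [&& word f \subset V, high_part f \subset W &
      [forall g, [&& g != f, word g \subset V & word g :&: low_rows == word f :&: low_rows]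
         ==> ~~ [disjoint W & high_part g :\: high_part f]]]]]].

(** Count the surviving words inside [W]. If [W] is isolated, pair every word but one with a fixed
    word [f0]; if not, every word has a competitor, counted in the last sum. *)
Lemma bonferroni_isolated V l W :
    W \subset ~: low_rows -> #|W| = (n - r + l)%N ->
  (\sum_f ((word f \subset V) && (high_part f \subset W)) <= (W \in isolated V l) +
   \sum_f \sum_(g | g != f) ((word f :|: word g \subset V) &&
                             (high_part f :|: high_part g \subset W)) +
   \sum_f \sum_(g | g != f) [&& word g :&: low_rows == word f :&: low_rows,
      word f :|: word g \subset V, high_part f \subset W &
      [disjoint W & high_part g :\: high_part f]])%N.
Proof.
move=> WY cW; rewrite inE WY cW eqxx /=.
case: (boolP [exists f, _]) => [/existsP[f0 /and3P[f0V f0W _]]|/existsPn none].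
  rewrite (leq_trans _ (leq_addr _ _)) // (bigD1 f0) //= f0V f0W leq_add2l.
  rewrite big_mkcond leq_sum // => f _; case: ifPn => // nf.
  rewrite (bigD1 f0) 1?eq_sym //= !subUset f0V f0W !andbT.
  exact: leq_addr.
rewrite add0n (leq_trans _ (leq_addl _ _)) // leq_sum // => f _.
have := none f; case: (word f \subset V) / boolP => //= fV.
case: (high_part f \subset W) / boolP => //= fW.
rewrite negb_forall => /existsP[g]; rewrite negb_imply negbK => /andP[/and3P[gf gV gl] dis].
by rewrite (bigD1 g) //= gl subUset fV gV dis.
Qed.

(** * Expected number of isolated sets *)

Section Expectation.
Variables (R : realFieldType) (p : R) (l : nat).
Hypothesis p01 : 0 <= p <= 1.
(** Once a word is placed in [W], the other [l] elements are chosen among [N1] high variables, with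
    density [lam]. *)
Let N1 := ((n - r) * m - (n - r))%N.
Hypothesis l_bounds : (n - r <= l <= N1)%N.
Hypothesis N1_gt0 : (0 < N1)%N.
Let lam : R := l%:R / N1%:R.

Let cols : {set {set 'I_(n * m)}} :=
  [set W : {set 'I_(n * m)} | W \subset ~: low_rows & #|W| == (n - r + l)%N].

Let high_sub f : high_part f \subset ~: low_rows.
Proof. by rewrite /high_part setDE subsetIr. Qed.

Lemma card_cols_containing f :
  #|[set W in cols | high_part f \subset W]| = 'C(N1, l).
Proof.
rewrite /N1 -card_high_rows -(card_high_part f) -[X in 'C(X, _)]subn0 -(cards0 'I_(n * m)).
rewrite -(card_draws_between _ (high_sub f)) ?sub0set //; last by rewrite disjoints_subset setC0 subsetT.
apply: eq_card => W; rewrite !inE card_high_part [[disjoint W & _]]disjoints_subset setC0 subsetT /= -!andbA.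
by congr (_ && _); rewrite andbC.
Qed.

Lemma card_cols_containing2 f g :
  (#|[set W in cols | high_part f :|: high_part g \subset W]|)%:R <=
    lam ^+ #|[set i in differ f g | (r <= i)%N]| * 'C(N1, l)%:R :> R.
Proof.
set j := #|[set i in differ f g | (r <= i)%N]|.
have jk : (j <= n - r)%N.
  by rewrite /j -card_high_ord; apply/subset_leq_card/subsetP=> i; rewrite !inE => /andP[].
have cU : #|high_part f :|: high_part g| = (n - r + j)%N.
  rewrite -(card_high_part f) /j -card_high_partD.
  have -> : high_part f :|: high_part g = high_part f :|: (high_part g :\: high_part f).
    by apply/setP=> x; rewrite !in_setU in_setD; case: (_ \in high_part f).
  rewrite cardsU (_ : _ :&: _ = set0) ?cards0 ?subn0 //.
  by apply/setP=> x; rewrite in_setI in_setD in_set0; case: (_ \in high_part f).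
have jl : (j <= l)%N by case/andP: l_bounds => kl _; apply: leq_trans kl.
have -> : #|[set W in cols | high_part f :|: high_part g \subset W]| = 'C(N1 - j, l - j).
  rewrite /N1 -subnDA -cU -card_high_rows -[X in 'C(X, _)]subn0 -(cards0 'I_(n * m)).
  rewrite -(card_draws_between _ (_ : high_part f :|: high_part g \subset ~: low_rows)) ?sub0set //;
    [|by rewrite subUset !high_sub|by rewrite disjoints_subset setC0 subsetT].
  apply: eq_card => W; rewrite !inE cU [[disjoint W & _]]disjoints_subset setC0 subsetT /= -!andbA.
  by congr (_ && _); rewrite andbC -addnA subnKC.
by case/andP: l_bounds => _ ?; apply: bin_sub_both_le.
Qed.

Lemma card_cols_avoiding f g :
  (#|[set W in cols | (high_part f \subset W) && [disjoint W & high_part g :\: high_part f]]|)%:R <=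
    (1 - lam) ^+ #|[set i in differ f g | (r <= i)%N]| * 'C(N1, l)%:R :> R.
Proof.
set j := #|[set i in differ f g | (r <= i)%N]|.
have -> : #|[set W in cols | (high_part f \subset W) && [disjoint W & high_part g :\: high_part f]]|
    = 'C(N1 - j, l).
  rewrite /N1 -card_high_rows -(card_high_part f) /j -card_high_partD.
  rewrite -card_draws_between ?high_sub //.
  - apply: eq_card => W; rewrite !inE card_high_part -!andbA.
    by congr (_ && _); rewrite andbC -andbA.
  - by rewrite (subset_trans (subsetDl _ _)).
  - by rewrite disjoint_sym disjoints_subset setDE subsetIr.
have [_ lN] := andP l_bounds.
have -> : 1 - lam = (N1 - l)%:R / N1%:R.
  by rewrite /lam (natrB _ lN) mulrBl divff // pnatr_eq0 -lt0n.
exact: bin_sub_top_le.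
Qed.

Lemma prod_high_rows (x : R) (A : {set 'I_n}) :
  \prod_(i in A) (if (i < r)%N then 1 else x) = x ^+ #|[set i in A | (r <= i)%N]|.
Proof.
rewrite (bigID (fun i : 'I_n => (i < r)%N)) /= big1 ?mul1r => [|i /andP[_ ->]] //.
rewrite (eq_bigr (fun=> x)) => [|i /andP[_ /negbTE ->]] //.
by rewrite prodr_const; congr (_ ^+ _); apply: eq_card => i; rewrite !inE unfold_in /= -leqNgt.
Qed.

(** Average the Bonferroni inequality over [V] and sum it over [W]. Relative to [f], a second word
    costs a factor [p] per differing position to survive, and per differing high position a factor
    [lam] to be contained or [1 - lam] to be avoided. The value 0 in low rows expresses that a
    competitor has the same low part. *)
Lemma expected_card_isolated :
    (forall f, \sum_(g | g != f) \prod_(i in differ f g) (p * (if (i < r)%N then 1 else lam)) +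
       \sum_(g | g != f) \prod_(i in differ f g) (if (i < r)%N then 0 else p * (1 - lam)) <= 1 / 2) ->
  1 / 2 * #|Phi|%:R * p ^+ n * 'C(N1, l)%:R <=
    \sum_(V : {set 'I_(n * m)}) bernoulli_weight p V * #|isolated V l|%:R.
Proof.
move=> small; have [p0 p1] := andP p01.
have lam01 : 0 <= lam <= 1.
  have [_ lN] := andP l_bounds.
  by rewrite /lam divr_ge0 //= ler_pdivrMr ?ltr0n // mul1r ler_nat.
have [lam0 lam1] := andP lam01.
set c2 := fun f g => (#|[set W in cols | high_part f :|: high_part g \subset W]|)%:R : R.
set c3 := fun f g => (#|[set W in cols | (high_part f \subset W) &&
   [disjoint W & high_part g :\: high_part f]]|)%:R : R.
have key V : \sum_f (word f \subset V)%:R * 'C(N1, l)%:R <= #|isolated V l|%:R +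
   \sum_f \sum_(g | g != f) (word f :|: word g \subset V)%:R * c2 f g +
   \sum_f \sum_(g | g != f) (word g :&: low_rows == word f :&: low_rows)%:R *
      (word f :|: word g \subset V)%:R * c3 f g :> R.
  have sumcols (P : pred {set 'I_(n * m)}) :
     (\sum_(W in cols) (P W : nat))%N = #|[set W in cols | P W]|.
    by rewrite -sum1_card big_mkcond [RHS]big_mkcond; apply: eq_bigr => W _;
      rewrite inE; case: (W \in cols) => //=; case: (P W).
  have : (\sum_(W in cols) \sum_f ((word f \subset V) && (high_part f \subset W)) <= \sum_(W in cols) ((W \in isolated V l) +
   \sum_f \sum_(g | g != f) ((word f :|: word g \subset V) &&
                             (high_part f :|: high_part g \subset W)) +
   \sum_f \sum_(g | g != f) [&& word g :&: low_rows == word f :&: low_rows,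
      word f :|: word g \subset V, high_part f \subset W &
      [disjoint W & high_part g :\: high_part f]]))%N.
    by apply: leq_sum => W; rewrite inE => /andP[WY /eqP cW]; apply: bonferroni_isolated.
  rewrite -(ler_nat R) !big_split /= exchange_big /= !natrD.
  have -> : (\sum_(W in cols) (W \in isolated V l) = #|isolated V l|)%N.
    rewrite (sumcols (mem (isolated V l))); apply: eq_card => W; rewrite !inE.
    by case: (_ \subset _) => //=; case: (_ == _).
  move=> H; apply: le_trans (le_trans H _).
    rewrite natr_sum; apply: ler_sum => f _.
    case: (word f \subset V); rewrite ?mul0r //= mul1r.
    by rewrite (sumcols (fun W => high_part f \subset W)) card_cols_containing.
  apply: lerD; [apply: lerD => //|].
    rewrite exchange_big /= natr_sum; apply: ler_sum => f _.
    rewrite exchange_big /= natr_sum; apply: ler_sum => g _.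
    case: (word f :|: word g \subset V) => /=; last by rewrite big1 ?mul0r.
    by rewrite mul1r (sumcols (fun W => high_part f :|: high_part g \subset W)).
  rewrite exchange_big /= natr_sum; apply: ler_sum => f _.
  rewrite exchange_big /= natr_sum; apply: ler_sum => g _.
  case: (_ == _) => /=; last by rewrite big1 ?mul0r.
  case: (word f :|: word g \subset V) => /=; last by rewrite big1 ?mulr0 ?mul0r.
  by rewrite !mul1r (sumcols (fun W => (high_part f \subset W) && [disjoint W & high_part g :\: high_part f])).
have w0 := bernoulli_weight_ge0 (T := 'I_(n * m)) p01.
have : \sum_(V : {set 'I_(n * m)}) bernoulli_weight p V *
    \sum_f (word f \subset V)%:R * 'C(N1, l)%:R <=
  \sum_(V : {set 'I_(n * m)}) bernoulli_weight p V * (#|isolated V l|%:R +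
   \sum_f \sum_(g | g != f) (word f :|: word g \subset V)%:R * c2 f g +
   \sum_f \sum_(g | g != f) (word g :&: low_rows == word f :&: low_rows)%:R *
      (word f :|: word g \subset V)%:R * c3 f g).
  by apply: ler_sum => V _; rewrite ler_wpM2l.
have -> : \sum_(V : {set 'I_(n * m)}) bernoulli_weight p V *
    \sum_f (word f \subset V)%:R * 'C(N1, l)%:R = #|Phi|%:R * p ^+ n * 'C(N1, l)%:R.
  under eq_bigr do rewrite mulr_sumr; rewrite exchange_big /=.
  rewrite (eq_bigr (fun=> p ^+ n * 'C(N1, l)%:R)) => [|f _].
    by rewrite sumr_const mulr_natl mulrnAl.
  under eq_bigr do rewrite mulrA.
  by rewrite -mulr_suml sum_bernoulli_weight_superset card_word.
under eq_bigr do rewrite !mulrDr; rewrite !big_split /=.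
set E := \sum_(V : {set _}) _ * #|_|%:R.
set E2 := (X in _ <= E + X + _); set E3 := (X in _ <= _ + X).
have E2le : E2 <= \sum_f p ^+ n * 'C(N1, l)%:R *
    \sum_(g | g != f) \prod_(i in differ f g) (p * (if (i < r)%N then 1 else lam)).
  rewrite /E2; under eq_bigr do rewrite mulr_sumr; rewrite exchange_big /=.
  apply: ler_sum => f _; under eq_bigr do rewrite mulr_sumr; rewrite exchange_big /= mulr_sumr.
  apply: ler_sum => g _; under eq_bigr do rewrite mulrA.
  rewrite -mulr_suml sum_bernoulli_weight_superset card_wordU exprD -!mulrA ler_wpM2l ?exprn_ge0 //.
  rewrite big_split /= prodr_const prod_high_rows [leRHS]mulrCA ler_wpM2l ?exprn_ge0 //.
  by rewrite [leRHS]mulrC; apply: card_cols_containing2.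
have E3le : E3 <= \sum_f p ^+ n * 'C(N1, l)%:R *
    \sum_(g | g != f) \prod_(i in differ f g) (if (i < r)%N then 0 else p * (1 - lam)).
  rewrite /E3; under eq_bigr do rewrite mulr_sumr; rewrite exchange_big /=.
  apply: ler_sum => f _; under eq_bigr do rewrite mulr_sumr; rewrite exchange_big /= mulr_sumr.
  apply: ler_sum => g _; case: eqP => [agree|_]; last first.
    rewrite big1 => [|V _]; last by rewrite !mul0r mulr0.
    rewrite !mulr_ge0 ?exprn_ge0 ?prodr_ge0 // => i _.
    by case: ifP => // _; rewrite mulr_ge0 ?subr_ge0.
  under eq_bigr do rewrite mul1r mulrA.
  rewrite -mulr_suml sum_bernoulli_weight_superset card_wordU exprD -!mulrA ler_wpM2l ?exprn_ge0 //.
  (* Words with equal low parts differ in high rows only, so the branch 0 is never taken. *)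
  rewrite (eq_bigr (fun i : 'I_n => p * (if (i < r)%N then 1 else 1 - lam))); last first.
    by move=> i /(eq_low_part_differ agree); rewrite ltnNge => ->.
  rewrite big_split /= prodr_const prod_high_rows [leRHS]mulrCA ler_wpM2l ?exprn_ge0 //.
  by rewrite [leRHS]mulrC; apply: card_cols_avoiding.
move=> H.
have E23 : E2 + E3 <= 1 / 2 * #|Phi|%:R * p ^+ n * 'C(N1, l)%:R.
  apply: le_trans (lerD E2le E3le) _; rewrite -big_split /=.
  have -> : 1 / 2 * #|Phi|%:R * p ^+ n * 'C(N1, l)%:R =
      \sum_(f : Phi) p ^+ n * 'C(N1, l)%:R * (1 / 2) :> R.
    by rewrite sumr_const -mulr_natl; ring.
  by apply: ler_sum => f _; rewrite -mulrDr ler_wpM2l ?mulr_ge0 ?exprn_ge0.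
move: H E23; set T := #|Phi|%:R * _ * _.
have -> : 1 / 2 * #|Phi|%:R * p ^+ n * 'C(N1, l)%:R = T / 2 by rewrite /T; field.
by move=> H1 H2; lra.
Qed.

End Expectation.

(** * Codes whose words agree in few positions *)

Hypothesis m_gt0 : (0 < m)%N.
Hypothesis agree_card : forall f (A : {set 'I_n}),
  (#|[set g | (g != f) && [forall i in A, code g i == code f i]]| * m ^ #|A| <= #|Phi|)%N.

(** Group the words [g] by the set [A] of positions where they agree with [f]; there are at most
    [#|Phi| / m ^ #|A|] of them. The sum over [A] is the expansion of the product on the right. *)
Lemma sum_prod_differ_le (R : realFieldType) (c : 'I_n -> R) f :
    (forall i, 0 <= c i) ->
  \sum_(g | g != f) \prod_(i in differ f g) c i <= #|Phi|%:R * \prod_i (m%:R^-1 + c i).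
Proof.
move=> c0; rewrite (partition_big (fun g => ~: differ f g) xpredT) //= bigA_distr mulr_sumr.
rewrite [leRHS](eq_bigl xpredT) => [|A]; last by rewrite inE.
apply: ler_sum => A _.
rewrite [X in _ <= _ * X](bigID (mem A)) /= [X in _ <= _ * (X * _)](eq_bigr (fun=> m%:R^-1)) => [|i ->] //.
rewrite prodr_const [X in _ <= _ * (_ * X)](eq_bigr c) => [|i /negbTE ->] //.
rewrite (eq_bigr (fun=> \prod_(i | i \notin A) c i)); last first.
  by move=> g /andP[_ /eqP <-]; apply: eq_bigl => i; rewrite [in RHS]in_setC negbK.
rewrite sumr_const -[leLHS]mulr_natl mulrA ler_wpM2r ?prodr_ge0 //.
rewrite exprVn ler_pdivlMr ?exprn_gt0 ?ltr0n // -natrX -natrM ler_nat.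
apply: leq_trans (agree_card f A); rewrite leq_mul2r; apply/orP; right.
apply/subset_leq_card/subsetP=> g; rewrite unfold_in inE => /andP[-> /eqP <-] /=.
by apply/forall_inP=> i; rewrite !inE negbK.
Qed.

Hypothesis differ_neq0 : forall f g, g != f -> exists i, i \in differ f g.

Lemma word_inj : injective word.
Proof.
move=> f g e; apply/eqP; apply: contraT => nfg; have [i] := differ_neq0 nfg.
have : mxvec_index i (code f i) \in word f by rewrite in_word.
by rewrite e in_word inE => /eqP ->; rewrite eqxx.
Qed.

(** * The polynomial of a code and its isolated columns *)

Section CodePolynomial.
Variable F : fieldType.

Definition code_poly : {mpoly F[n * m]} := \sum_f 'X_[mesym1 (word f)].

Lemma mcoeff_code_poly_word f : code_poly@_(mesym1 (word f)) = 1.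
Proof.
rewrite raddf_sum (bigD1 f) //= mcoeffX eqxx big1 ?addr0 // => g ngf.
by rewrite mcoeffX (inj_eq (@inj_mesym1 _)) (inj_eq word_inj) (negbTE ngf).
Qed.

Lemma mcoeff_code_poly_neq0 A : code_poly@_(mesym1 A) != 0 -> exists f, A = word f.
Proof.
move=> nz; case: (pickP (fun f => word f == A)) => [f /eqP <-|none]; first by exists f.
move: nz; rewrite raddf_sum big1 ?eqxx // => f _.
by rewrite /= mcoeffX (inj_eq (@inj_mesym1 _)) none.
Qed.

(** The row of [W] is given by the low part of a witness [f] and by [W] minus its high part. A
    nonzero entry at [W'] yields a surviving word [g] with the same low part whose new high
    variables avoid [W]; isolation gives [g = f], and then [W' = W]. *)
Lemma isolated_columns (V : {set 'I_(n * m)}) l :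
  exists y U : {set 'I_(n * m)} -> {set 'I_(n * m)},
   {in isolated V l, forall W : {set 'I_(n * m)}, [/\ W \subset ~: low_rows, (r + #|W| = n + l)%N,
       y W \subset low_rows, #|y W| = r & #|U W| = l]} /\
   {in isolated V l &, forall W W' : {set 'I_(n * m)}, (if U W \subset W' then
       (restr V code_poly)@_(mesym1 (y W :|: (W' :\: U W))) else 0) = (W == W')%:R}.
Proof.
pose P (W : {set 'I_(n * m)}) f := [&& word f \subset V, high_part f \subset W &
      [forall g, [&& g != f, word g \subset V & word g :&: low_rows == word f :&: low_rows]
         ==> ~~ [disjoint W & high_part g :\: high_part f]]].
pose y W := if [pick f | P W f] is Some f then word f :&: low_rows else set0.
pose U W := if [pick f | P W f] is Some f then W :\: high_part f else set0.
have isoP W : W \in isolated V l -> [/\ W \subset ~: low_rows, #|W| = (n - r + l)%N &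
    exists f, [/\ P W f, y W = word f :&: low_rows & U W = W :\: high_part f]].
  rewrite inE => /and3P[WY /eqP cW /existsP[f Pf]]; split=> //.
  rewrite /y /U; case: pickP => [g Pg|/(_ f)]; first by exists g.
  by rewrite /P Pf.
exists y, U; split=> [W /isoP[WY cW [f [/and3P[fV fW _] yE UE]]]|W W' /isoP[WY cW [f [Pf yE UE]]] /isoP[WY' cW' _]].
  split=> //; rewrite ?yE ?UE ?subsetIr ?card_low_part //.
    by rewrite cW addnA subnKC.
  by rewrite cardsD (setIidPr fW) cW card_high_part addKn.
have /and3P[fV fW /forallP iso] := Pf; rewrite yE UE.
have wordE g : word g = (word g :&: low_rows) :|: high_part g by rewrite setID.
have lowF x : x \in low_rows -> x \in W' -> false by move=> xl /(subsetP WY'); rewrite inE xl.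
case: (W =P W') => [<-|nWW'].
  rewrite subsetDl setDDr setDv set0U (setIidPr fW) -wordE mcoeff_restr fV.
  exact: mcoeff_code_poly_word.
case: ifPn => // sUW'; rewrite mcoeff_restr; case: ifPn => // sV.
apply/eqP; apply: contraT => /mcoeff_code_poly_neq0[g gE].
have gl : word g :&: low_rows = word f :&: low_rows.
  rewrite -gE; apply/setP=> x; rewrite !in_setI in_setU in_setI !in_setD.
  have := lowF x; case: (x \in low_rows); rewrite ?andbF // !andbT.
  by case: (x \in W') => [/(_ isT isT)|]; rewrite ?andbF ?orbF.
have gh : high_part g = W' :\: (W :\: high_part f).
  rewrite /high_part -gE; apply/setP=> x; rewrite !(in_setD, in_setI, in_setU).
  have := lowF x; case: (x \in low_rows); rewrite /= ?andbF ?andbT //=.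
  by case: (x \in W') => [/(_ isT isT)|]; rewrite ?andbF ?orbF.
have [gf|ngf] := eqVneq g f.
  case: nWW'; move: gh fW sUW'; rewrite gf; move: (high_part f) => H gh fW sUW'.
  apply/setP=> x; have := congr1 (fun A : {set _} => x \in A) gh; rewrite /= !in_setD.
  have := subsetP sUW' x; rewrite in_setD; have := subsetP fW x.
  by case: (x \in H); case: (x \in W); case: (x \in W') => //= h1 h2 h3;
    do ?[by have := h1 isT | by have := h2 isT].
have := iso g; rewrite ngf gl eqxx andbT /= -gE sV /= => /negP[].
rewrite disjoints_subset gh; move: (high_part f) => H.
by apply/subsetP=> x xW; rewrite in_setC !in_setD xW; case: (x \in H).
Qed.

(** Average [#|isolated V l| - big * bad V], where [bad V] counts the surviving monomials with more
    than [s] variables: the first term has mean at least [X / 2], the second at most [X / 4]. Hence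
    some [V] gives at least [X / 4], and the rank bound applies to it. *)
Lemma circuit_size_dichotomy (R : realFieldType) (p : R) (l s : nat)
    (C : spsp_circuit F (n * m)) :
  let N1 := ((n - r) * m - (n - r))%N in
  let lam := l%:R / N1%:R in
  let X := #|Phi|%:R * p ^+ n * 'C(N1, l)%:R in
    0 < p <= 1 -> (n - r <= l <= N1)%N -> (0 < N1)%N -> (0 < #|Phi|)%N ->
    #|Phi|%:R * \prod_(i < n) (m%:R^-1 + p * (if (i < r)%N then 1 else lam)) +
    #|Phi|%:R * \prod_(i < n) (m%:R^-1 + (if (i < r)%N then 0 else p * (1 - lam))) <= 1 / 2 ->
    homogeneous_circuit C -> circuit_poly C = code_poly ->
    (monos C)%:R * p ^+ s.+1 * 'C((n - r) * m, n - r + l)%:R <= 4^-1 * X ->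
  4^-1 * X <= (prods C * #|[set J : {set 'I_n} | (#|J| <= r)%N]| *
     #|[set B : {set 'I_(n * m)} | B \subset ~: low_rows & (l <= #|B| <= l + r * s)%N]|)%:R.
Proof.
move=> N1 lam X /andP[p0 p1] /andP[kl lN] N10 Phi0 small hom CE kill.
have p01 : 0 <= p <= 1 by rewrite ltW.
have lam0 : 0 <= lam by rewrite divr_ge0.
have lam1 : lam <= 1 by rewrite ler_pdivrMr ?ltr0n // mul1r ler_nat.
have X0 : 0 < X.
  by rewrite /X !mulr_gt0 ?exprn_gt0 ?ltr0n ?bin_gt0.
have EX : 1 / 2 * X <=
    \sum_(V : {set 'I_(n * m)}) bernoulli_weight p V * #|isolated V l|%:R.
  rewrite /X !mulrA; apply: expected_card_isolated => //; first by rewrite kl.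
  move=> f; apply: le_trans small; apply: lerD; apply: sum_prod_differ_le => i.
    by rewrite mulr_ge0 ?(ltW p0) //; case: ifP => _; rewrite ?ler01.
  by case: ifP => // _; rewrite mulr_ge0 ?subr_ge0 // ltW.
set big := 'C((n - r) * m, n - r + l)%:R in kill.
pose bad (V : {set 'I_(n * m)}) : R := \sum_(i : 'I_(monos C) | (s < #|mono_vars i|)%N) (mono_vars i \subset V)%:R.
have Ebad : \sum_(V : {set 'I_(n * m)}) bernoulli_weight p V * bad V <= (monos C)%:R * p ^+ s.+1.
  under eq_bigr do rewrite mulr_sumr; rewrite exchange_big /=.
  apply: (@le_trans _ _ (\sum_(i : 'I_(monos C) | (s < #|mono_vars i|)%N) p ^+ s.+1)).
    apply: ler_sum => i si; rewrite sum_bernoulli_weight_superset.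
    by rewrite ler_wiXn2l // ltW.
  rewrite sumr_const -[leLHS]mulr_natl ler_wpM2r ?exprn_ge0 ?(ltW p0) // ler_nat.
  by rewrite -[X in (_ <= X)%N]card_ord max_card.
have big0 : 0 <= big by [].
have [|V HV] := @exists_ge_expectation R _ p p01 (fun V => #|isolated V l|%:R - big * bad V) (4^-1 * X).
  under eq_bigr do rewrite mulrBr [big * _]mulrC [_ * (_ * big)]mulrA; rewrite sumrB -mulr_suml.
  have : (\sum_(V : {set 'I_(n * m)}) bernoulli_weight p V * bad V) * big <= 4^-1 * X.
    by apply: le_trans kill; rewrite ler_wpM2r.
  by move: EX; set S1 := \sum_(V : {set _}) _ * #|_|%:R; set S2 := _ * big; lra.
have iso_le : #|isolated V l|%:R <= big.
  rewrite ler_nat -(card_high_rows) -cards_draws; apply/subset_leq_card/subsetP=> W.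
  by rewrite !inE => /and3P[-> ->].
(* One large surviving monomial would cost [big], which is at least the number of isolated sets, and
   the difference could not be positive. *)
have bad0 (i : 'I_(monos C)) : mono_vars i \subset V -> (#|mono_vars i| <= s)%N.
  move=> iV; rewrite leqNgt; apply/negP => si.
  have : 1 <= bad V.
    rewrite /bad (bigD1 i) //= iV lerDl sumr_ge0 //.
  move=> /(ler_wpM2l big0); rewrite mulr1; move: HV iso_le X0; set S1 := #|_|%:R; set S2 := big * bad V.
  by move=> h1 h2 h3 h4; lra.
have [y [U [H1 H2]]] := isolated_columns V l.
have := leq_card_isolated_columns hom bad0 H1; rewrite CE => /(_ H2).
rewrite -(ler_nat R); apply: le_trans; apply: le_trans HV _.
rewrite lerBlDr lerDl mulr_ge0 // sumr_ge0 //.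
Qed.

End CodePolynomial.
End Codes.

(** * The Nisan-Wigderson code *)

Section NisanWigderson.
Variables (K L : finFieldType) (iota : {rmorphism K -> L}) (n D : nat).
Variables (phi : 'I_n -> K) (psi : L -> 'I_(n ^ 2)).
Hypotheses (card_L : #|L| = (n ^ 2)%N) (phi_bij : bijective phi) (psi_bij : bijective psi).

Definition nw_code (f : {poly_D L}) (i : 'I_n) : 'I_(n ^ 2) :=
  psi (f : {poly L}).[iota (phi i)].

Let point (i : 'I_n) : L := iota (phi i).

Let point_inj : injective point.
Proof. by move=> i j /fmorph_inj /(bij_inj phi_bij). Qed.

Let points (A : {set 'I_n}) : seq L := [seq point i | i <- enum A].

Let points_uniq A : uniq (points A).
Proof. by rewrite map_inj_uniq ?enum_uniq. Qed.

Let points_size A : size (points A) = #|A|.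
Proof. by rewrite size_map -cardE. Qed.

Let points_root (f g : {poly_D L}) (A : {set 'I_n}) :
  [forall i in A, nw_code g i == nw_code f i] ->
  all (root ((g : {poly L}) - (f : {poly L}))) (points A).
Proof.
move=> /forall_inP agr; apply/allP=> _ /mapP[i iA ->]; rewrite mem_enum in iA.
by rewrite rootE hornerD hornerN subr_eq0; have := agr _ iA; rewrite (inj_eq (bij_inj psi_bij)).
Qed.

Let size_sub (f g : {poly_D L}) : (size ((g : {poly L}) - (f : {poly L}))%R <= D)%N.
Proof. by rewrite (leq_trans (size_polyD _ _)) // size_polyN geq_max !size_npoly. Qed.

Lemma nw_code_agree_eq (f g : {poly_D L}) (A : {set 'I_n}) : (D <= #|A|)%N ->
  [forall i in A, nw_code g i == nw_code f i] -> g = f.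
Proof.
move=> DA agr; apply: val_inj; apply/eqP; rewrite -subr_eq0; apply: contraT => nz.
have := max_poly_roots nz (points_root agr) (points_uniq A).
by rewrite points_size ltnNge (leq_trans (size_sub f g)).
Qed.

(** For [#|A| < D], the polynomial [q] with roots at the points of [A] divides [g - f], and the
    quotient, which determines [g], has fewer than [D - #|A|] free degrees plus one. For [#|A| >= D]
    no [g] other than [f] is left. *)
Lemma nw_code_agree_card (f : {poly_D L}) (A : {set 'I_n}) :
  (#|[set g | (g != f) && [forall i in A, nw_code g i == nw_code f i]]| * (n ^ 2) ^ #|A|
     <= #|{poly_D L}|)%N.
Proof.
rewrite card_npoly card_L; have [DA|AD] := leqP D #|A|.
  rewrite (_ : [set g | _] = set0) ?cards0 //; apply/setP=> g; rewrite !inE.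
  by apply/negP=> /andP[/eqP gf /(nw_code_agree_eq DA)].
rewrite -[X in (_ <= _ ^ X)%N](subnK (ltnW AD)) expnD leq_mul2r; apply/orP; right.
have <- : #|{poly_(D - #|A|) L}| = ((n ^ 2) ^ (D - #|A|))%N by rewrite card_npoly card_L.
pose q := \prod_(z <- points A) ('X - z%:P).
pose h (g : {poly_D L}) := npolyp (D - #|A|) (((g : {poly L}) - (f : {poly L})) %/ q).
have sq : size q = #|A|.+1 by rewrite size_prod_XsubC points_size.
have hE g : [forall i in A, nw_code g i == nw_code f i] ->
    (h g : {poly L}) * q = (g : {poly L}) - (f : {poly L}).
  move=> agr; rewrite /h npolypK; last first.
    rewrite size_divp -?size_poly_eq0 ?sq //= leq_sub2r //; exact: size_sub.
  rewrite divpK // uniq_roots_dvdp ?uniq_rootsE ?points_uniq //; exact: points_root.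
rewrite -(card_in_imset (f := h)) ?max_card // => g1 g2.
rewrite !inE => /andP[_ /hE e1] /andP[_ /hE e2] e; apply: val_inj.
by apply: (addIr (- (f : {poly L}))); rewrite -e1 -e2 e.
Qed.

Lemma nw_code_differ (f g : {poly_D L}) : (D <= n)%N -> g != f ->
  exists i, i \in differ nw_code f g.
Proof.
move=> Dn gf; apply/existsP; apply: contraNT gf => /existsPn agr; apply/eqP.
apply: (@nw_code_agree_eq f g [set: 'I_n]); first by rewrite cardsT card_ord.
by apply/forall_inP=> i _; have := agr i; rewrite inE negbK.
Qed.

Lemma NW_code_poly (F : fieldType) : NW F iota phi psi D = code_poly nw_code F.
Proof.
apply: eq_bigr => f _; rewrite mprodXE; congr 'X_[_]; apply/mnmP=> x.
rewrite mnm_sumE mnmE; case/mxvec_indexP: x => i j; rewrite in_word.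
rewrite (bigD1 i) //= big1 ?addn0 => [|i' ni]; rewrite mnmE.
  by congr (nat_of_bool _); apply/eqP/eqP => [/mxvec_index_inj[]|<-].
by apply/eqP; rewrite eqb0; apply: contraNN ni => /eqP/mxvec_index_inj[->].
Qed.

End NisanWigderson.

(** * Choice of the parameters *)

Lemma leq_bin_expn n j : ('C(n, j) <= n ^ j)%N.
Proof.
elim: j n => [|j IH] [|n] //.
have := mul_bin_diag n.+1 j; rewrite /= => E.
apply: (@leq_trans (j.+1 * 'C(n.+1, j.+1))%N); first by rewrite leq_pmull.
rewrite -E expnS leq_mul2l (leq_trans (IH n)) //=.
by case: j {IH E} => // j; rewrite leq_exp2r.
Qed.

Lemma card_subsets_between (T : finType) (E : {set T}) (a t : nat) :
  #|[set A : {set T} | A \subset E & (a <= #|A| <= a + t)%N]| =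
    (\sum_(j < t.+1) 'C(#|E|, a + j))%N.
Proof.
under eq_bigr do rewrite -cards_draws -sum1_card.
rewrite -sum1_card (partition_big (fun A : {set T} => inord (#|A| - a) : 'I_t.+1) xpredT) //=.
apply: eq_bigr => j _; apply: eq_bigl => A; rewrite !inE -andbA; congr (_ && _).
apply/andP/eqP => [[/andP[aA At] /eqP <-]|->].
  by rewrite inordK ?ltnS ?leq_subLR // subnKC.
by rewrite leq_addr leq_add2l -ltnS ltn_ord addKn inord_val.
Qed.

Lemma card_small_subsets_le n r : (0 < n)%N ->
  (#|[set J : {set 'I_n} | (#|J| <= r)%N]| <= r.+1 * n ^ r)%N.
Proof.
move=> n0; have := card_subsets_between [set: 'I_n] 0 r; rewrite cardsT card_ord => E.
rewrite (_ : [set J : {set 'I_n} | (#|J| <= r)%N] =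
  [set A : {set 'I_n} | A \subset [set: 'I_n] & (0 <= #|A| <= 0 + r)%N]); last first.
  by apply/setP=> J; rewrite !inE subsetT.
rewrite E -[X in (X * _)%N]card_ord -sum_nat_const leq_sum // => j _.
by rewrite add0n (leq_trans (leq_bin_expn _ _)) // leq_pexp2l // -ltnS.
Qed.

Lemma bin_add_both_le (a b j : nat) : (b <= a)%N ->
  (b ^ j * 'C(a + j, b + j) <= a ^ j * 'C(a, b))%N.
Proof.
move=> ba; elim: j => [|j IH]; first by rewrite !addn0.
have E := mul_bin_diag (a + j).+1 (b + j); rewrite /= in E.
have step : (b * 'C(a + j.+1, b + j.+1) <= a * 'C(a + j, b + j))%N.
  rewrite !addnS -(@leq_pmul2l (b + j).+1) // mulnCA -E mulnA [X in (_ <= X)%N]mulnA leq_mul //.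
  by nia.
rewrite !expnS -mulnA mulnCA; apply: (@leq_trans (b ^ j * (a * 'C(a + j, b + j)))%N).
  by rewrite leq_mul2l step orbT.
by rewrite mulnCA -mulnA leq_mul2l IH orbT.
Qed.

(** Between [l + t] and [l + k], consecutive binomials grow by a factor of at least
    [(N - l - k) / (l + k)]. *)
Lemma bin_climb_le (N l k t : nat) : (l + k <= N)%N -> (t <= k)%N ->
  ((N - l - k) ^ (k - t) * 'C(N, l + t) <= (l + k) ^ (k - t) * 'C(N, l + k))%N.
Proof.
move=> lkN tk; have [j kE] : exists j, k = (t + j)%N by exists (k - t)%N; rewrite subnKC.
have -> : (k - t)%N = j by rewrite kE addKn.
elim: j t kE tk => [|j IH] t kE tk; first by rewrite kE addn0.
have IHt := IH t.+1; rewrite addSnnS in IHt; have {IHt} IHt := IHt kE ltac:(lia).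
have E := mul_bin_left N (l + t).
have step : ((N - l - k) * 'C(N, l + t) <= (l + k) * 'C(N, l + t.+1))%N.
  apply: (@leq_trans ((N - (l + t)) * 'C(N, l + t))%N); first by rewrite leq_mul2r; apply/orP; right; lia.
  by rewrite -E addnS leq_mul2r; apply/orP; right; lia.
rewrite !expnS -mulnA mulnCA; apply: leq_trans (_ : (_ <= (N - l - k) ^ j * ((l + k) * 'C(N, l + t.+1)))%N) _.
  by rewrite leq_mul2l step orbT.
by rewrite mulnCA -mulnA leq_mul2l IHt orbT.
Qed.

(** Take the largest [l] satisfying the third condition. It holds at [N %/ 8], where
    [7 * l <= N - l]. *)
Lemma exists_balanced (k N Q : nat) : (0 < k)%N -> (0 < Q)%N -> (Q <= 7 ^ k)%N ->
  exists l, [/\ (N %/ 8 <= l)%N, (l <= N)%N, (Q * l ^ k <= (N - l) ^ k)%N &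
                ((N - l.+1) ^ k <= Q * l.+1 ^ k)%N].
Proof.
move=> k0 Q0 Q7; pose P l := (l <= N)%N && (Q * l ^ k <= (N - l) ^ k)%N.
have P8 : P (N %/ 8)%N.
  rewrite /P leq_div /=; apply: (@leq_trans (7 ^ k * (N %/ 8) ^ k)%N); first by rewrite leq_mul2r Q7 orbT.
  by rewrite -expnMn leq_exp2r //; lia.
have Pex : exists l, P l by exists (N %/ 8)%N.
have Pub l : P l -> (l <= N)%N by case/andP.
case: (ex_maxnP Pex Pub) => l /andP[lN Ql] lmax; exists l; split=> //; first exact: lmax.
have [Nl|lN'] := leqP N l; first by rewrite (_ : N - l.+1 = 0)%N ?exp0n //; lia.
apply/contraT; rewrite -ltnNge => H.
by have := lmax l.+1; rewrite /P lN' (ltnW H) ltnn => /(_ isT).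
Qed.

Section Reals.
Variable R : realType.

Lemma ln2_ge_half : 1 / 2 <= ln 2 :> R.
Proof.
have := @le_ln1Dx R (- (1 / 2)) ltac:(lra).
have -> : 1 + - (1 / 2) = 2^-1 :> R by field.
by rewrite lnV ?posrE //; lra.
Qed.

(** The logarithm of the power is at most [t * n <= 1 <= ln 4]. Every rounding loss in the choice of
    parameters is bounded this way. *)
Lemma expr1D_le4 (t : R) (n : nat) : 0 <= t -> t * n%:R <= 1 -> (1 + t) ^+ n <= 4.
Proof.
move=> t0 tn; have t1 : 0 < 1 + t by lra.
rewrite -ler_ln ?posrE ?exprn_gt0 // lnXn // -[leLHS]mulr_natr.
have h1 : ln (1 + t) <= t by apply: le_ln1Dx; lra.
have h2 : ln (1 + t) * n%:R <= t * n%:R by rewrite ler_wpM2r.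
have -> : ln 4 = ln 2 + ln 2 :> R by rewrite -lnM ?posrE //; congr ln; ring.
by have := ln2_ge_half; lra.
Qed.

Lemma exists_root (y : R) (k : nat) : 0 < y -> (0 < k)%N -> exists2 p : R, 0 < p & p ^+ k = y.
Proof.
move=> y0 k0; exists (powR y k%:R^-1); first exact: powR_gt0.
rewrite -powR_mulrn ?powR_ge0 // -powRrM mulVf ?pnatr_eq0 -?lt0n //.
by rewrite powRr1 // ltW.
Qed.

Lemma prod_if_lt (n r : nat) (a b : R) : (r <= n)%N ->
  \prod_(i < n) (if (i < r)%N then a else b) = a ^+ r * b ^+ (n - r).
Proof.
move=> rn; rewrite (bigID (fun i : 'I_n => (i < r)%N)) /=.
rewrite (eq_bigr (fun=> a)) => [|i ->] //.
rewrite [X in _ * X](eq_bigr (fun=> b)) => [|i /negbTE ->] //.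
rewrite !prodr_const -{3}(card_low_ord rn) -(card_high_ord rn).
by congr (_ ^+ _ * _ ^+ _); apply: eq_card => i; rewrite !inE unfold_in /= -?leqNgt.
Qed.

End Reals.

(** From [n <= (16 * r) ^ 2 <= 7 ^ (6 * r)] the left side is at most [7 ^ (12 * r ^ 2)], while
    [n - r >= 63 * r ^ 2]. This allows [Q = n ^ (2 * r)] in [exists_balanced]. *)
Lemma expn_le_exp7 (n r : nat) : (0 < r)%N -> (64 * r ^ 2 <= n)%N -> (n < 64 * r.+1 ^ 2)%N ->
  (n ^ (2 * r) <= 7 ^ (n - r))%N.
Proof.
move=> r0 rn nr.
have n16 : (n <= (16 * r) ^ 2)%N by rewrite expnMn; nia.
have r7 : (16 * r <= 7 ^ (3 * r))%N.
  apply: (@leq_trans (7 ^ 2 * 7 ^ r)%N); last by rewrite -expnD leq_exp2l //; lia.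
  by rewrite leq_mul // ltnW // ltn_expl.
apply: (@leq_trans (((7 ^ (3 * r)) ^ 2) ^ (2 * r))%N).
  rewrite leq_exp2r ?muln_gt0 // (leq_trans n16) // leq_exp2r //.
by rewrite -!expnM leq_exp2l //; nia.
Qed.

Lemma balanced_bounds (n k N l : nat) : (1000 <= n)%N -> (k <= n)%N -> (0 < k)%N ->
    N = (k * (n ^ 2 - 1))%N -> (N %/ 8 <= l)%N ->
  (0 < N)%N /\ [/\ (k * k <= l)%N, (k <= l)%N, (0 < l)%N, (N <= 9 * l)%N & (4 * k <= N)%N].
Proof.
move=> n1000 kn k0 NE l8.
have n2 : (1000 * n <= n ^ 2)%N by rewrite expnS expn1 leq_mul2r n1000 orbT.
have Nbig : (k * (100 * n) <= N)%N by rewrite NE leq_mul2l; apply/orP; right; lia.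
have kk : (k * k <= k * n)%N by rewrite leq_mul2l kn orbT.
have k1 : (k <= k * k)%N by rewrite leq_pmulr.
have nkn : (n <= k * n)%N by rewrite leq_pmull.
have Nbig' : (100 * (k * n) <= N)%N by rewrite mulnCA.
by move: kk k1 nkn Nbig' l8 k0 n1000; clear; split; [lia|split; lia].
Qed.

(** With [mu = 1 - lam], the choice of [l] puts [(mu / lam) ^ k] between [n ^ (2 * r)] and
    [16 * n ^ (2 * r)]. Then [p] solves [16 * a * (p * mu) ^ k = 1] for [a = n ^ (2 * (D - r))],
    which makes each of the two error terms at most [1 / 4]. *)
Lemma exists_parameters (R : realType) (n r D : nat) (B : R)
    (k := (n - r)%N) (N1 := (k * n ^ 2 - k)%N) :
    (24 <= r)%N -> (64 * r ^ 2 <= n)%N -> (n < 64 * r.+1 ^ 2)%N ->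
    (r <= D)%N -> (10 * D <= n)%N -> 1 <= B ->
    (2 * B) ^+ k <= n%:R ^+ (2 * (D - r)) ->
  exists (p : R) (l : nat), let lam := l%:R / N1%:R : R in
  [/\ 0 < p <= 1, (k <= l <= N1)%N, (0 < N1)%N,
      (n ^ 2)%:R ^+ D * \prod_(i < n) ((n ^ 2)%:R^-1 + p * (if (i < r)%N then 1 else lam)) +
      (n ^ 2)%:R ^+ D * \prod_(i < n) ((n ^ 2)%:R^-1 + (if (i < r)%N then 0 else p * (1 - lam)))
        <= 1 / 2 &
  [/\ p * B <= 1, 1 <= p ^+ 2 * n%:R,
      p ^+ r / 256 * 'C(k * n ^ 2, k + l)%:R <= (n ^ 2)%:R ^+ D * p ^+ n * 'C(N1, l)%:R &
      exists2 tau : R, 1 <= tau & n%:R ^+ (2 * r) / 4 <= tau ^+ k /\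
        forall t, (t <= k)%N -> 'C(k * n ^ 2, l + t)%:R * tau ^+ (k - t) <= 'C(k * n ^ 2, k + l)%:R]].
Proof.
move=> r24 r_le r_gt rD Dn B_ge1 B_le.
have r0 : (0 < r)%N by lia.
have rn64 : (64 * r <= n)%N by nia.
have n81 : (1000 <= n)%N by lia.
have k0 : (0 < k)%N by rewrite /k; lia.
have kn : (k <= n)%N by rewrite /k; lia.
have nkr : n = (k + r)%N by rewrite /k; lia.
have k63 : (63 * n <= 64 * k)%N by rewrite /k; lia.
have Dk : (1 + 2 * (D - r) * 2 <= k)%N by lia.
have n0 : (0 < n)%N by lia.
have n256 : (256 <= n)%N by lia.
have rn : (r <= n)%N by lia.
have r2 : (1 <= 2 * r)%N by lia.
have Q7 := expn_le_exp7 r0 r_le r_gt.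
have Q0 : (0 < n ^ (2 * r))%N by rewrite expn_gt0; lia.
have [l [l8 lN Ql Ql1]] := @exists_balanced k N1 _ k0 Q0 Q7.
have N1E : N1 = (k * (n ^ 2 - 1))%N by rewrite /N1 mulnBr muln1.
have [N10 [kkl kl l0 N9 kN1]] := balanced_bounds n81 kn k0 N1E l8.
have l2 : (2 * l <= N1)%N.
  have : (l ^ k <= (N1 - l) ^ k)%N by apply: leq_trans Ql; rewrite leq_pmull.
  by rewrite leq_exp2r //; move: lN; clear; lia.
have kNl : (k <= N1 - l.+1)%N by move: l2 kN1; clear; lia.
have lN' : (l < N1)%N by move: l2 l0; clear; lia.
have kN : (k <= k * n ^ 2)%N by rewrite leq_pmulr // expn_gt0 n0.
have lkN : (l + k <= k * n ^ 2)%N by move: lN kN; rewrite /N1; clear; lia.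
set lam : R := l%:R / N1%:R; pose mu : R := 1 - lam.
pose x : R := n%:R.
have x0 : 0 < x by rewrite ltr0n.
have N1R : 0 < N1%:R :> R by rewrite ltr0n.
have lam9 : 1 / 9 <= lam.
  have : N1%:R <= 9 * l%:R :> R by rewrite -natrM ler_nat.
  by rewrite /lam ler_pdivlMr //; clear; lra.
have lam2 : lam <= 1 / 2.
  have : 2 * l%:R <= N1%:R :> R by rewrite -natrM ler_nat.
  by rewrite /lam ler_pdivrMr //; clear; lra.
have muE : mu = (N1 - l)%:R / N1%:R.
  by rewrite /mu /lam (natrB _ lN) mulrBl divff // gt_eqF.
have mu2 : 1 / 2 <= mu by rewrite /mu; move: lam2; clear; lra.
have mu1 : mu <= 1 by rewrite /mu; move: lam9; clear; lra.
have mu0 : 0 < mu by apply: lt_le_trans mu2; rewrite divr_gt0.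
have lam0 : 0 < lam by apply: lt_le_trans lam9; rewrite divr_gt0.
have xn1 : (1 + x^-1) ^+ n <= 4 :> R.
  by apply: expr1D_le4; rewrite ?invr_ge0 ?(ltW x0) // mulVf ?gt_eqF.
have Qlam : x ^+ (2 * r) * lam ^+ k <= mu ^+ k.
  rewrite muE /lam !expr_div_n mulrA ler_pM2r ?invr_gt0 ?exprn_gt0 //.
  by rewrite -!natrX -natrM ler_nat.
(* The reverse inequality is known at [l.+1]; passing to [l] costs a factor 4 on each side. *)
have Qmu : mu ^+ k <= 16 * x ^+ (2 * r) * lam ^+ k.
  rewrite muE /lam !expr_div_n mulrA ler_pM2r ?invr_gt0 ?exprn_gt0 //.
  have pos1 : 0 < (N1 - l.+1)%:R :> R by rewrite ltr0n (leq_trans k0).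
  have pos2 : 0 < l%:R :> R by rewrite ltr0n.
  have e1 : (N1 - l)%:R = (N1 - l.+1)%:R * (1 + (N1 - l.+1)%:R^-1) :> R.
    by rewrite mulrDr mulr1 divff ?gt_eqF // natr1 subnSK.
  have e2 : l.+1%:R = l%:R * (1 + l%:R^-1) :> R.
    by rewrite mulrDr mulr1 divff ?gt_eqF // natr1.
  have b1 : (1 + (N1 - l.+1)%:R^-1) ^+ k <= 4 :> R.
    apply: expr1D_le4; first by rewrite invr_ge0.
    by rewrite mulrC ler_pdivrMr // mul1r ler_nat.
  have b2 : (1 + l%:R^-1) ^+ k <= 4 :> R.
    apply: expr1D_le4; first by rewrite invr_ge0.
    by rewrite mulrC ler_pdivrMr // mul1r ler_nat.
  have h : (N1 - l.+1)%:R ^+ k <= x ^+ (2 * r) * (l%:R ^+ k * (1 + l%:R^-1) ^+ k) :> R.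
    by rewrite -exprMn -e2 -!natrX -natrM ler_nat.
  rewrite e1 exprMn.
  have x2r : 0 <= x ^+ (2 * r) by rewrite exprn_ge0 // ltW.
  have lk0 : 0 <= l%:R ^+ k :> R by rewrite exprn_ge0.
  apply: (@le_trans _ _ (x ^+ (2 * r) * (l%:R ^+ k * 4) * 4)); last by rewrite le_eqVlt; apply/orP; left; apply/eqP; ring.
  apply: ler_pM; [by rewrite exprn_ge0| |  |exact: b1].
    by rewrite exprn_ge0 // addr_ge0 // invr_ge0.
  by apply: le_trans h _; rewrite ler_wpM2l // ler_wpM2l.
pose a : R := x ^+ (2 * (D - r)).
have a0 : 0 < a by rewrite exprn_gt0.
have [p p0 pE] := @exists_root R (16 * a * mu ^+ k)^-1 k ltac:(by rewrite invr_gt0 !mulr_gt0 ?exprn_gt0) k0.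
have PE : 16 * a * (p * mu) ^+ k = 1.
  by rewrite exprMn pE mulrCA mulVf // gt_eqF // !mulr_gt0 ?exprn_gt0.
have aPE : a * (p * mu) ^+ k = 1 / 16 by move: PE; rewrite -mulrA; move: (a * _) => T; clear; lra.
have pB : p * B <= 1.
  have pB0 : 0 <= p * B by rewrite mulr_ge0 ?(ltW p0) // (le_trans _ B_ge1).
  rewrite -(expr_le1 k0) // exprMn.
  have h1 : B ^+ k <= a * mu ^+ k.
    apply: (@le_trans _ _ ((2 * B) ^+ k * mu ^+ k)).
      rewrite -exprMn lerXn2r ?nnegrE //; move: B_ge1 mu2; clear; nra.
    by rewrite ler_wpM2r ?exprn_ge0 // ltW.
  apply: (@le_trans _ _ (p ^+ k * (a * mu ^+ k))); first by rewrite ler_wpM2l ?exprn_ge0 // ltW.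
  by rewrite mulrCA -exprMn aPE; clear; lra.
have p1 : p <= 1.
  by apply: le_trans pB; rewrite ler_peMr // ltW.
(* Compare [k]-th powers: [(16 * a) ^ 2 <= n ^ k], since [256 <= n] and [1 + 4 * (D - r) <= k]. *)
have px : 1 <= p ^+ 2 * x.
  have px0 : 0 <= p ^+ 2 * x by rewrite mulr_ge0 ?exprn_ge0 // ltW.
  rewrite -(expr_ge1 k0) // exprMn.
  have h : (16 * a) ^+ 2 <= x ^+ k.
    have e16 : 16 ^+ 2 = 256%:R :> R by rewrite expr2 -natrM.
    rewrite exprMn e16.
    apply: (@le_trans _ _ (x ^+ 1 * a ^+ 2)).
      by rewrite ler_wpM2r ?exprn_ge0 ?(ltW x0) ?(ltW p0) ?(ltW a0) ?(ltW mu0) ?(ltW lam0) // expr1 ler_nat.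
    by rewrite /a -exprM -exprD ler_weXn2l // ler1n.
  apply: (@le_trans _ _ ((16 * a * (p * mu) ^+ k) ^+ 2)); first by rewrite PE expr1n.
  rewrite exprMn [leLHS]mulrC; apply: (@le_trans _ _ ((p ^+ 2) ^+ k * (16 * a) ^+ 2)).
    rewrite ler_wpM2r ?exprn_ge0 ?mulr_ge0 ?(ltW x0) ?(ltW p0) ?(ltW a0) ?(ltW mu0) ?(ltW lam0) // -exprM mulnC exprM lerXn2r ?nnegrE ?exprn_ge0 ?mulr_ge0 ?(ltW x0) ?(ltW p0) ?(ltW a0) ?(ltW mu0) ?(ltW lam0) //.
    rewrite lerXn2r ?nnegrE ?exprn_ge0 ?mulr_ge0 ?(ltW x0) ?(ltW p0) ?(ltW a0) ?(ltW mu0) ?(ltW lam0) //.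
    by rewrite ler_piMr // ltW.
  by rewrite ler_wpM2l ?exprn_ge0 ?(ltW x0) ?(ltW p0) ?(ltW a0) ?(ltW mu0) ?(ltW lam0).
have xp9 : 9 <= x * p.
  have h : 9 ^+ 2 <= (x * p) ^+ 2.
    rewrite exprMn expr2 [x ^+ 2]expr2 -mulrA [x * p ^+ 2]mulrC.
    apply: (@le_trans _ _ (x * 1)); last by rewrite ler_wpM2l // ltW.
    by rewrite mulr1 -natrM ler_nat (leq_trans _ n256).
  by move: h; rewrite ler_sqr ?nnegrE // mulr_ge0 // ltW.
have mE : (n ^ 2)%:R = x ^+ 2 by rewrite natrX.
have invE : (n ^ 2)%:R^-1 = x^-1 * x^-1 by rewrite mE expr2 invfM.
have aQ : (n ^ 2)%:R ^+ D = a * x ^+ (2 * r).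
  by rewrite mE -exprM /a -exprD -mulnDr subnK.
(* As [n * p >= 9], the summand [n ^ -2] is at most [p * z / n]; over all positions this costs at
   most the factor 4 of [xn1]. *)
have step z : 1 / 9 <= z -> (n ^ 2)%:R^-1 + p * z <= p * z * (1 + x^-1).
  move=> z9; rewrite invE mulrDr mulr1 addrC lerD2l ler_wpM2r ?invr_ge0 ?(ltW x0) ?(ltW p0) ?(ltW a0) ?(ltW mu0) ?(ltW lam0) //.
  rewrite -[leLHS]mul1r ler_pdivrMr //.
  by rewrite mulrAC [p * x]mulrC; move: z9 xp9; clear; nra.
have ax0 : 0 <= a * x ^+ (2 * r) by rewrite mulr_ge0 ?exprn_ge0 // ltW.
have ap0 : 0 <= a * p ^+ k by rewrite mulr_ge0 ?exprn_ge0 // ltW.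
have inv0 : 0 <= (n ^ 2)%:R^-1 :> R by rewrite invr_ge0.
have x10 : 0 <= 1 + x^-1 by rewrite addr_ge0 // invr_ge0 ltW.
exists p, l; split=> //; rewrite ?p0 ?p1 ?kl ?lN //.
  rewrite -/lam (eq_bigr (fun i : 'I_n => if (i < r)%N then (n ^ 2)%:R^-1 + p * 1 else (n ^ 2)%:R^-1 + p * lam)); last first.
    by move=> i _; case: ifP.
  rewrite [X in _ + _ * X](eq_bigr (fun i : 'I_n => if (i < r)%N then (n ^ 2)%:R^-1 else (n ^ 2)%:R^-1 + p * mu)); last first.
    by move=> i _; case: ifP; rewrite ?addr0.
  rewrite !prod_if_lt // aQ.
  have S1 : ((n ^ 2)%:R^-1 + p * 1) ^+ r * ((n ^ 2)%:R^-1 + p * lam) ^+ k <= p ^+ r * (p * lam) ^+ k * 4.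
    apply: (@le_trans _ _ ((p * 1 * (1 + x^-1)) ^+ r * (p * lam * (1 + x^-1)) ^+ k)).
      have b1 : (n ^ 2)%:R^-1 + p * 1 <= p * 1 * (1 + x^-1) by apply: step; clear; lra.
      have b2 := step _ lam9.
      have c1 : 0 <= (n ^ 2)%:R^-1 + p * 1 by rewrite addr_ge0 // mulr_ge0 // ltW.
      have c2 : 0 <= (n ^ 2)%:R^-1 + p * lam by rewrite addr_ge0 // mulr_ge0 // ltW.
      apply: ler_pM (exprn_ge0 _ c1) (exprn_ge0 _ c2) _ _.
        by apply: lerXn2r; rewrite ?nnegrE // (le_trans c1 b1).
      by apply: lerXn2r; rewrite ?nnegrE // (le_trans c2 b2).
    rewrite mulr1 (exprMn r p) (exprMn k (p * lam)) mulrACA.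
    have -> : (1 + x^-1) ^+ r * (1 + x^-1) ^+ k = (1 + x^-1) ^+ n.
      by rewrite -exprD; congr (_ ^+ _); rewrite addnC.
    by apply: ler_wpM2l xn1; apply: mulr_ge0; apply: exprn_ge0;
      [apply: ltW | apply: mulr_ge0; apply: ltW].
  have S1' : a * x ^+ (2 * r) * (((n ^ 2)%:R^-1 + p * 1) ^+ r * ((n ^ 2)%:R^-1 + p * lam) ^+ k) <= 1 / 4.
    apply: (@le_trans _ _ (a * x ^+ (2 * r) * (p ^+ r * (p * lam) ^+ k * 4))).
      exact: ler_wpM2l S1.
    apply: (@le_trans _ _ (p ^+ r * (a * (p ^+ k * mu ^+ k)) * 4)).
      have -> : a * x ^+ (2 * r) * (p ^+ r * (p * lam) ^+ k * 4) =
         p ^+ r * (a * (p ^+ k * (x ^+ (2 * r) * lam ^+ k))) * 4 by rewrite exprMn; ring.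
      rewrite ler_wpM2r // ler_wpM2l ?exprn_ge0 ?(ltW p0) // ler_wpM2l ?(ltW a0) //.
      by rewrite ler_wpM2l ?exprn_ge0 ?(ltW p0).
    rewrite -exprMn aPE; have : p ^+ r <= 1 by rewrite exprn_ile1 // ltW.
    by clear; lra.
  have S2 : a * x ^+ (2 * r) * ((n ^ 2)%:R^-1 ^+ r * ((n ^ 2)%:R^-1 + p * mu) ^+ k) <= 1 / 4.
    have -> : a * x ^+ (2 * r) * ((n ^ 2)%:R^-1 ^+ r * ((n ^ 2)%:R^-1 + p * mu) ^+ k) =
        a * ((n ^ 2)%:R^-1 + p * mu) ^+ k.
      rewrite mE exprVn exprM -mulrA [X in a * X]mulrA divff ?mul1r //.
      by rewrite gt_eqF // !exprn_gt0.
    apply: (@le_trans _ _ (a * ((p * mu) ^+ k * 4))).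
      rewrite ler_wpM2l ?(ltW a0) //; apply: (@le_trans _ _ ((p * mu * (1 + x^-1)) ^+ k)).
        have b : (n ^ 2)%:R^-1 + p * mu <= p * mu * (1 + x^-1).
          by apply: step; move: mu2; clear; lra.
        have c : 0 <= (n ^ 2)%:R^-1 + p * mu by rewrite addr_ge0 // mulr_ge0 // ltW.
        by apply: lerXn2r; rewrite ?nnegrE // (le_trans c b).
      rewrite exprMn ler_wpM2l ?exprn_ge0 ?mulr_ge0 ?(ltW p0) ?(ltW mu0) //.
      apply: le_trans xn1; rewrite ler_weXn2l //; by rewrite lerDl invr_ge0 ltW.
    by rewrite mulrA aPE; clear; lra.
  by move: S1' S2; rewrite -/k; clear; lra.
(* Here [N1 + k = k * n ^ 2]. *)
have Cb : lam ^+ k * 'C(k * n ^ 2, k + l)%:R <= 'C(N1, l)%:R :> R.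
  have := bin_add_both_le k lN; rewrite [(N1 + k)%N]subnK // [(l + k)%N]addnC => h.
  rewrite /lam expr_div_n mulrAC ler_pdivrMr ?exprn_gt0 // -!natrX -!natrM ler_nat.
  by rewrite [X in (_ <= X)%N]mulnC.
have lk0 : 0 < (l + k)%:R :> R by rewrite ltr0n addn_gt0 l0.
split=> //.
  rewrite aQ.
  apply: (@le_trans _ _ (a * x ^+ (2 * r) * p ^+ n * (lam ^+ k * 'C(k * n ^ 2, k + l)%:R))); last first.
    by apply: ler_wpM2l Cb; rewrite mulr_ge0 // exprn_ge0 // ltW.
  rewrite mulrA ler_wpM2r // nkr addnC exprD.
  have -> : a * x ^+ (2 * r) * (p ^+ r * p ^+ k) * lam ^+ k = p ^+ r * (a * p ^+ k * (x ^+ (2 * r) * lam ^+ k)) by ring.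
  rewrite ler_wpM2l ?exprn_ge0 ?(ltW p0) //.
  have h : a * p ^+ k * mu ^+ k <= a * p ^+ k * (16 * x ^+ (2 * r) * lam ^+ k).
    exact: ler_wpM2l Qmu.
  move: h; rewrite -mulrA -exprMn aPE.
  have -> : a * p ^+ k * (16 * x ^+ (2 * r) * lam ^+ k) = 16 * (a * p ^+ k * (x ^+ (2 * r) * lam ^+ k)) by ring.
  by move: (a * _ * _) => T; clear; lra.
(* The growth rate of [bin_climb_le]; replacing [l] by [l + k] in the denominator costs a factor 4,
   because [k * k <= l]. *)
pose tau : R := (N1 - l)%:R / (l + k)%:R.
have tau0 : 0 <= tau by rewrite divr_ge0.
have tauk : x ^+ (2 * r) / 4 <= tau ^+ k.
  rewrite /tau expr_div_n ler_pdivlMr ?exprn_gt0 //.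
  have e : (l + k)%:R = l%:R * (1 + k%:R / l%:R) :> R.
    by rewrite mulrDr mulr1 mulrCA divff ?mulr1 ?natrD // pnatr_eq0 -lt0n.
  have b : (1 + k%:R / l%:R) ^+ k <= 4 :> R.
    apply: expr1D_le4; first by rewrite divr_ge0.
    by rewrite mulrAC ler_pdivrMr ?ltr0n // mul1r -natrM ler_nat.
  rewrite e exprMn; apply: (@le_trans _ _ (x ^+ (2 * r) * l%:R ^+ k)); last by rewrite -!natrX -natrM ler_nat.
  have -> : x ^+ (2 * r) / 4 * (l%:R ^+ k * (1 + k%:R / l%:R) ^+ k) =
     x ^+ (2 * r) * l%:R ^+ k * ((1 + k%:R / l%:R) ^+ k / 4) by ring.
  rewrite ler_piMr ?mulr_ge0 ?exprn_ge0 ?(ltW x0) //.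
  by rewrite ler_pdivrMr // mul1r.
exists tau.
  rewrite -(expr_ge1 k0) //; apply: le_trans tauk.
  rewrite ler_pdivlMr // mul1r; apply: (@le_trans _ _ (x ^+ 1)); first by rewrite expr1 ler_nat (leq_trans _ n256).
  by rewrite ler_weXn2l ?ler1n.
split=> // t tk; rewrite [(k + l)%N]addnC.
have := bin_climb_le lkN tk.
have -> : (k * n ^ 2 - l - k = N1 - l)%N by rewrite /N1 -!subnDA addnC.
rewrite -(ler_nat R) !natrM !natrX => h.
rewrite /tau expr_div_n mulrA ler_pdivrMr ?exprn_gt0 // mulrC [leRHS]mulrC //.
Qed.

(** Take [s = 3 * r]. If the first alternative fails, there are few bottom monomials and the rank
    bound gives [key]. Its sixteenth power, with [p ^ 2 >= 1 / n] and [16 * (k - t) >= 15 * k],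
    yields the exponent [30 * r - 8 * r - 16 * r = 6 * r]. *)
Lemma nw_circuit_lower_bound (R : realType) (n r D : nat) (B : R)
    (F : fieldType) (K L : finFieldType) (iota : {rmorphism K -> L})
    (phi : 'I_n -> K) (psi : L -> 'I_(n ^ 2)) (C : spsp_circuit F (n * n ^ 2)) :
    (24 <= r)%N -> (64 * r ^ 2 <= n)%N -> (n < 64 * r.+1 ^ 2)%N ->
    (r <= D)%N -> (10 * D <= n)%N -> 1 <= B ->
    (2 * B) ^+ (n - r) <= n%:R ^+ (2 * (D - r)) ->
    #|L| = (n ^ 2)%N -> bijective phi -> bijective psi ->
    homogeneous_circuit C -> circuit_poly C = NW F iota phi psi D ->
  B ^+ (2 * r) <= 1024 * (circuit_size C)%:R \/
  n%:R ^+ (6 * r) <= ((circuit_size C)%:R * n%:R ^+ 3) ^+ 16 :> R.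
Proof.
move=> r24 r_le r_gt rD Dn B1 BD cL phib psib hom CE.
have rn64 : (64 * r <= n)%N by nia.
have rn : (r <= n)%N by lia.
have n0 : (0 < n)%N by lia.
have Dn' : (D <= n)%N by lia.
have [p [l [p01 klN N10 small [pB px Xlow [tau tau1 [tauk climb]]]]]] :=
  exists_parameters r24 r_le r_gt rD Dn B1 BD.
have [p0 p1] := andP p01; have [kl lN] := andP klN.
have [|small_size] := leP (B ^+ (2 * r)) (1024 * (circuit_size C)%:R); [by left | right].
set k := (n - r)%N in klN N10 small Xlow tauk climb kl lN *.
set N := (k * n ^ 2)%N in climb Xlow *.
set big := 'C(N, k + l)%:R in climb Xlow *.
pose x : R := n%:R; pose S : R := (circuit_size C)%:R.
have x0 : 0 < x by rewrite ltr0n.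
have x1 : 1 <= x by rewrite ler1n.
have S0 : 0 <= S by [].
have monoS : (monos C)%:R <= S by rewrite ler_nat /circuit_size; clear; lia.
have prodS : (prods C)%:R <= S by rewrite ler_nat /circuit_size; clear; lia.
have rs48 : (16 * (r * (3 * r)) <= k)%N by move: r_le rn64; rewrite /k; clear; nia.
have big0 : 0 < big.
  rewrite ltr0n bin_gt0 /N; move: klN N10; rewrite -/k -/N; clear; lia.
have PhiE : #|{poly_D L}| = ((n ^ 2) ^ D)%N by rewrite card_npoly cL.
set X := (n ^ 2)%:R ^+ D * p ^+ n * 'C(k * n ^ 2 - k, l)%:R in Xlow.
(* A factor [p ^ (2 * r)] pays for the number of monomials, and [p ^ r] matches the one in the lower
   bound for [X]; [1024 = 4 * 256]. *)
have kill : (monos C)%:R * p ^+ (3 * r).+1 * big <= 4^-1 * X.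
  have pr0 : 0 <= p ^+ r by rewrite exprn_ge0 // ltW.
  have h1 : (monos C)%:R * p ^+ (2 * r) <= 1 / 1024.
    have pB2 : (p * B) ^+ (2 * r) <= 1 by rewrite exprn_ile1 // mulr_ge0 ?(ltW p0) // (le_trans _ B1).
    have : 1024 * (monos C)%:R * p ^+ (2 * r) <= B ^+ (2 * r) * p ^+ (2 * r).
      rewrite ler_wpM2r ?exprn_ge0 ?(ltW p0) //; apply: le_trans (ltW small_size).
      by rewrite ler_wpM2l.
    rewrite -exprMn [B * p]mulrC -mulrA; move: pB2; move: ((p * B) ^+ _) => u.
    by move: (_ * p ^+ _) => v; clear; lra.
  have h2 : (monos C)%:R * p ^+ (3 * r).+1 <= p ^+ r / 1024.
    apply: (@le_trans _ _ ((monos C)%:R * (p ^+ (2 * r) * p ^+ r))).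
      rewrite ler_wpM2l // -exprD ler_wiXn2l ?(ltW p0) //; clear; lia.
    by rewrite mulrA [leRHS]mulrC ler_wpM2r // -[leRHS]mul1r.
  apply: (@le_trans _ _ (p ^+ r / 1024 * big)); first by rewrite ler_wpM2r ?(ltW big0).
  move: Xlow; set u := p ^+ r; move: X => X' h.
  have -> : u / 1024 * big = 4^-1 * (u / 256 * big) by field.
  by rewrite ler_pM2l ?invr_gt0.
have m0 : (0 < n ^ 2)%N by rewrite expn_gt0 n0.
have dich := @circuit_size_dichotomy n (n ^ 2) r _ (@nw_code K L iota n D phi psi) rn m0
  (nw_code_agree_card iota cL phib psib)
  (fun f g => @nw_code_differ _ _ iota _ _ _ _ phib psib f g Dn') F R p l (3 * r) C.
rewrite PhiE (natrX R (n ^ 2) D) in dich.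
have {dich} := dich p01 klN N10 _ small hom _ kill.
rewrite expn_gt0 m0 => /(_ isT); rewrite CE NW_code_poly => /(_ erefl).
rewrite (card_subsets_between _ l) card_high_rows // -/k -/N -/X.
set nB := (\sum_(j < _) _)%N => main.
have tau0 : 0 < tau by apply: lt_le_trans tau1.
pose t := (r * (3 * r))%N.
have nBle : nB%:R * tau ^+ (k - t) <= t.+1%:R * big.
  rewrite /nB natr_sum mulr_suml.
  apply: (@le_trans _ _ (\sum_(j < t.+1) big)); last by rewrite sumr_const card_ord -[leLHS]mulr_natl.
  apply: ler_sum => j _; have jt : (j <= t)%N by rewrite -ltnS.
  have tk : (t <= k)%N by move: rs48; rewrite -/t; clear; lia.
  apply: le_trans (climb j (leq_trans jt tk)); rewrite ler_wpM2l //.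
  by rewrite ler_weXn2l // leq_sub2l.
have Jle := card_small_subsets_le r n0.
have key : p ^+ r * tau ^+ (k - t) * 4 <= S * x ^+ 3 * x ^+ r.
  (* The factor [n ^ 3] absorbs the polynomial losses from counting [J] and [B], and the constant
     [4 * 1024]. *)
  have n3 : (4096 * (r.+1 * t.+1) <= n ^ 3)%N.
    have e6 : (r ^ 6 = (r ^ 2) ^ 3)%N by rewrite -expnM.
    have r6 : (64 ^ 3 * r ^ 6 <= n ^ 3)%N by rewrite e6 -expnMn leq_exp2r.
    apply: leq_trans r6; rewrite /t; have r8 : (r.+1 * (r * (3 * r)).+1 <= 8 * r ^ 3)%N.
      have -> : (8 * r ^ 3 = (2 * r) * (4 * (r * r)))%N by rewrite !expnS expn0; clear; lia.
      rewrite leq_mul //; first by move: r24; clear; lia.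
      by move: r24; clear; nia.
    have r36 : (r ^ 3 <= r ^ 6)%N by rewrite leq_pexp2l //; move: r24; clear; lia.
    apply: (@leq_trans (4096 * (8 * r ^ 3))%N); first by rewrite leq_mul2l r8 orbT.
    by rewrite mulnA; apply: leq_mul r36.
  have h : p ^+ r / 1024 * tau ^+ (k - t) * big <= S * (r.+1 * n ^ r)%:R * t.+1%:R * big.
    apply: (@le_trans _ _ (4^-1 * X * tau ^+ (k - t))).
      have -> : p ^+ r / 1024 * tau ^+ (k - t) * big = 4^-1 * (p ^+ r / 256 * big) * tau ^+ (k - t) by field.
      by rewrite ler_wpM2r ?exprn_ge0 ?(ltW tau0) // ler_pM2l ?invr_gt0.
    apply: (@le_trans _ _ ((prods C * #|[set J : {set 'I_n} | (#|J| <= r)%N]|)%:R * (nB%:R * tau ^+ (k - t)))).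
      by rewrite mulrA -natrM ler_wpM2r ?exprn_ge0 ?(ltW tau0).
    rewrite -[leRHS]mulrA; apply: ler_pM => //; first by rewrite mulr_ge0 ?exprn_ge0 ?(ltW tau0).
    by rewrite natrM; apply: ler_pM => //; rewrite ler_nat.
  move: h; rewrite ler_pM2r // natrM natrX -/x => h.
  have h3 : 4096 * (r.+1%:R * t.+1%:R) <= x ^+ 3 by rewrite /x -natrX -!natrM ler_nat.
  apply: (@le_trans _ _ (S * (4096 * (r.+1%:R * t.+1%:R)) * x ^+ r)); last first.
    by rewrite ler_wpM2r ?exprn_ge0 ?(ltW x0) // ler_wpM2l.
  have -> : S * (4096 * (r.+1%:R * t.+1%:R)) * x ^+ r = 4096 * (S * (r.+1%:R * x ^+ r) * t.+1%:R) by ring.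
  move: h; have -> : p ^+ r / 1024 * tau ^+ (k - t) = p ^+ r * tau ^+ (k - t) / 1024 by ring.
  by move: (p ^+ r * _) => u; move: (S * _ * _) => v; clear; lra.
have key16 : (p ^+ r * tau ^+ (k - t) * 4) ^+ 16 <= (S * x ^+ 3 * x ^+ r) ^+ 16.
  by apply: lerXn2r => //; rewrite nnegrE ?mulr_ge0 ?exprn_ge0 ?(ltW p0) ?(ltW tau0) ?(ltW x0).
have px16 : 1 <= p ^+ (16 * r) * x ^+ (8 * r).
  have -> : (16 * r = 2 * (8 * r))%N by clear; lia.
  by rewrite exprM -exprMn exprn_ege1.
have tau16 : (x ^+ (2 * r) / 4) ^+ 15 <= tau ^+ ((k - t) * 16).
  apply: (@le_trans _ _ ((tau ^+ k) ^+ 15)).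
    apply: lerXn2r => //; rewrite nnegrE ?exprn_ge0 ?(ltW tau0) //.
    by rewrite mulr_ge0 ?invr_ge0 ?exprn_ge0 ?(ltW x0).
  rewrite -exprM ler_weXn2l //; move: rs48; rewrite -/t; clear; lia.
have fin : x ^+ (30 * r) <= (S * x ^+ 3) ^+ 16 * x ^+ (24 * r).
  apply: (@le_trans _ _ ((p ^+ r * tau ^+ (k - t) * 4) ^+ 16 * x ^+ (8 * r))); last first.
    apply: (@le_trans _ _ ((S * x ^+ 3 * x ^+ r) ^+ 16 * x ^+ (8 * r))).
      by rewrite ler_wpM2r ?exprn_ge0 ?(ltW x0).
    rewrite (exprMn 16 (S * x ^+ 3)) -mulrA -exprM -exprD.
    by rewrite (_ : r * 16 + 8 * r = 24 * r)%N //; clear; lia.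
  rewrite (exprMn 16 (_ * _)) (exprMn 16 (p ^+ r)) -!exprM [(r * 16)%N]mulnC.
  have -> : p ^+ (16 * r) * tau ^+ ((k - t) * 16) * 4 ^+ 16 * x ^+ (8 * r) =
    (p ^+ (16 * r) * x ^+ (8 * r)) * (tau ^+ ((k - t) * 16) * 4 ^+ 16) by ring.
  rewrite -[leLHS]mul1r; apply: ler_pM => //; first by rewrite exprn_ge0 // ltW.
  apply: (@le_trans _ _ ((x ^+ (2 * r) / 4) ^+ 15 * 4 ^+ 16)); last by rewrite ler_wpM2r ?exprn_ge0.
  have -> : (x ^+ (2 * r) / 4) ^+ 15 * 4 ^+ 16 = (x ^+ (2 * r)) ^+ 15 * 4 :> R.
    by move: (x ^+ _) => u; field.
  rewrite -exprM (_ : 2 * r * 15 = 30 * r)%N; last by clear; lia.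
  by rewrite ler_peMr ?exprn_ge0 ?(ltW x0) // ler1n.
move: fin; rewrite (_ : 30 * r = 6 * r + 24 * r)%N; last by clear; lia.
by rewrite exprD ler_pM2r // exprn_gt0.
Qed.

(** * The range of d *)

Lemma ln_le_sqrt (R : realType) (x : R) : 0 < x -> ln x <= 2 * Num.sqrt x.
Proof.
move=> x0; have s0 : 0 < Num.sqrt x by rewrite sqrtr_gt0.
rewrite -{1}(sqr_sqrtr (ltW x0)) lnXn // -[leLHS]mulr_natl.
by rewrite ler_pM2l // ltW // ln_sublinear.
Qed.

(** The quotient is a product of the [k] factors [(N - k - i) / (m - i)], which lie between
    [(N - k) / m >= 3 / 2] and [(N - 2 * k) / (m - k) <= 4]. *)
Lemma bin_ratio_bounds (R : realType) (N k m : nat) :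
    (k <= m)%N -> (m + k <= N)%N -> (3 * m + 2 * k <= 2 * N)%N -> (N + 2 * k <= 4 * m)%N -> (0 < m)%N ->
  (3 / 2) ^+ k <= ('C(N - k, m)%:R / 'C(N - 2 * k, m - k)%:R : R) <= 4 ^+ k.
Proof.
move=> km mkN up low m0.
have C0 : 0 < 'C(N - 2 * k, m - k)%:R :> R by rewrite ltr0n bin_gt0; lia.
rewrite ler_pdivlMr // ler_pdivrMr //; apply/andP; split.
  have mN : (m <= N - k)%N by lia.
  have Nk0 : (0 < N - k)%N by lia.
  have := bin_sub_both_le R km mN Nk0; rewrite -subnDA addnn -mul2n => h.
  apply: (le_trans (ler_wpM2l _ h)); first by rewrite exprn_ge0 // divr_ge0.
  rewrite mulrA -exprMn ler_piMl // exprn_ile1 //.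
    by rewrite !mulr_ge0 ?invr_ge0.
  have : 3 * m%:R <= 2 * (N - k)%:R :> R by rewrite -!natrM ler_nat; lia.
  by rewrite mulrA ler_pdivrMr ?ltr0n //; lra.
have h := @bin_add_both_le (N - 2 * k) (m - k) k ltac:(lia).
have e1 : (N - 2 * k + k = N - k)%N by lia.
have e2 : (m - k + k = m)%N by lia.
rewrite e1 e2 in h.
have mk0 : (0 < m - k)%N by lia.
rewrite -(ler_pM2l (_ : 0 < (m - k)%:R ^+ k :> R)); last by rewrite exprn_gt0 // ltr0n.
rewrite -!natrX -!natrM ler_nat (leq_trans h) // mulnA leq_mul2r -expnMn; apply/orP; right.
have: (N - 2 * k <= (m - k) * 4)%N by lia.
by move: (N - 2 * k)%N ((m - k) * 4)%N => u v uv; case: (k) => // k'; rewrite leq_exp2r.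
Qed.

(** Taking logarithms, [2 * d * ln n] differs by [O(ln n)] from the logarithm of the binomial ratio,
    which lies between [k * ln (3 / 2)] and [k * ln 4]. *)
Lemma d_range (R : realType) (eps : R) (n r k m d D : nat) :
    1000 ^+ 2 <= n%:R :> R -> nw_parameters eps n r k m d D ->
  1 / 24 * (n%:R / ln n%:R) <= (d%:R : R) <= 1 * (n%:R / ln n%:R).
Proof.
move=> nbig [rr k_def mr [dlow dup] _]; subst k.
pose x : R := n%:R; pose s := Num.sqrt x; pose y := ln x.
have x0 : 0 < x by apply: lt_le_trans nbig; rewrite exprn_gt0.
have s2 : s ^+ 2 = x by rewrite /s sqr_sqrtr // ltW.
have s1000 : 1000 <= s.
  by rewrite -(ler_pXn2r (n := 2)) ?nnegrE ?sqrtr_ge0 // s2.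
have y0 : 0 < y.
  by rewrite /y ln_gt0 //; apply: lt_le_trans nbig; rewrite exprn_egt1 // ltr1n.
have ys : y <= 2 * s by apply: ln_le_sqrt.
have rs : r%:R <= s.
  move: rr; rewrite /rounds -/x -/s ltr_norml => /andP[_].
  by move: s1000; clear; lra.
have s_le_x : 1000 * s <= x by rewrite -s2 expr2 ler_wpM2r // sqrtr_ge0.
have rn : (r <= n)%N by rewrite -(ler_nat R) -/x; move: rs s_le_x s1000; clear; lra.
have kE : (n - r)%:R = x - r%:R :> R by rewrite natrB.
have kx : 1 / 2 * x <= (n - r)%:R :> R by rewrite kE; move: rs s_le_x s1000; clear; lra.
have N0 : (n ^ 3)%:R = x ^+ 3 :> R by rewrite natrX.
have Nbig : 1000 * x <= x ^+ 3.
  rewrite exprSr ler_wpM2r ?(ltW x0) // -s2 -exprM.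
  apply: le_trans (_ : 1000 ^+ 4 <= _); last by apply: lerXn2r; rewrite ?nnegrE ?sqrtr_ge0.
  by rewrite -[leLHS]expr1 ler_weXn2l // ler1n.
have u0 : 0 <= y / (5 * s) by rewrite divr_ge0 ?(ltW y0) // mulr_ge0 // sqrtr_ge0.
have u1 : y / (5 * s) <= 2 / 5.
  rewrite ler_pdivrMr; first by move: ys; clear; lra.
  by rewrite mulr_gt0 //; apply: lt_le_trans s1000.
have N30 : 0 <= x ^+ 3 by rewrite exprn_ge0 // ltW.
have [mlow mup] : 3 / 10 * x ^+ 3 - 1 <= m%:R /\ m%:R <= x ^+ 3 / 2 + 1.
  move: mr; rewrite /rounds N0 -/x -/s -/y ltr_norml => /andP[].
  move: u0 u1 N30; move: (y / _) (x ^+ 3) m%:R => u v w; clear => h1 h2 h3 h4 h5.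
  by split; nra.
have x1000 : 1000 <= x by move: s_le_x s1000; clear; lra.
have kup : (n - r)%:R <= x by rewrite ler_nat leq_subr.
have k0 : 0 <= (n - r)%:R :> R by [].
set k := (n - r)%N in kx kup k0 dlow dup *.
have h1 : (k <= m)%N by rewrite -(ler_nat R); move: mlow kup Nbig x1000; clear; lra.
have h2 : (m + k <= n ^ 3)%N by rewrite -(ler_nat R) natrD N0; move: mup kup Nbig x1000; clear; lra.
have h3 : (3 * m + 2 * k <= 2 * n ^ 3)%N.
  by rewrite -(ler_nat R) natrD (natrM R 3) (natrM R 2 k) (natrM R 2) N0; move: mup kup Nbig x1000; clear; lra.
have h4 : (n ^ 3 + 2 * k <= 4 * m)%N.
  by rewrite -(ler_nat R) natrD (natrM R 2) (natrM R 4) N0; move: mlow kup Nbig x1000; clear; lra.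
have h5 : (0 < m)%N by rewrite -(ltr_nat R); move: mlow Nbig x1000; clear; lra.
have := bin_ratio_bounds R h1 h2 h3 h4 h5; move: dlow dup; rewrite /d_target.
set rho := 'C(n ^ 3 - k, m)%:R / 'C(n ^ 3 - 2 * k, m - k)%:R => dlow dup /andP[rlow rup].
have x2 : 0 < x ^+ 2 by rewrite exprn_gt0.
have xd0 : 0 < x ^+ (2 * d) by rewrite exprn_gt0.
have lnd : ln (x ^+ (2 * d)) = 2 * d%:R * y.
  by rewrite lnXn // -[LHS]mulr_natl natrM.
have ln2_1 : ln 2 <= 1 :> R.
  by have := @le_ln1Dx R 1 ltac:(clear; lra); rewrite (_ : 1 + 1 = 2).
have ln4E : ln 4 = ln 2 + ln 2 :> R by rewrite -lnM ?posrE //; congr ln; ring.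
have ln32 : 1 / 3 <= ln (3 / 2) :> R.
  have := @le_ln1Dx R (- (1 / 3)) ltac:(clear; lra).
  have -> : 1 + - (1 / 3) = (3 / 2)^-1 :> R by field.
  by rewrite lnV ?posrE ?divr_gt0 //; move: (ln _) => z; clear; lra.
apply/andP; split.
  (* The factor [4 * n ^ 2] comes from [d_target], the other [n ^ 2] from the rounding of [d]. *)
  have low : (3 / 2) ^+ k <= x ^+ (2 * d) * (4 * x ^+ 4).
    apply: le_trans rlow _; move: (ltW dlow); rewrite -/x ler_pdivrMr //.
    have -> : 4^-1 * x ^- 2 * rho = rho / (4 * x ^+ 2) by field; rewrite gt_eqF.
    rewrite ler_pdivrMr ?mulr_gt0 // => /le_trans; apply.
    by rewrite le_eqVlt; apply/orP; left; apply/eqP; ring.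
  have p1 : 0 < (3 / 2) ^+ k :> R by rewrite exprn_gt0 // divr_gt0.
  have p2 : 0 < 4 * x ^+ 4 by rewrite mulr_gt0 // exprn_gt0.
  have x4 : 0 < x ^+ 4 by rewrite exprn_gt0.
  have {low} : ln ((3 / 2) ^+ k) <= ln (x ^+ (2 * d) * (4 * x ^+ 4)).
    by rewrite ler_ln ?posrE // mulr_gt0.
  rewrite (lnM (x := x ^+ (2 * d))) ?posrE // (lnM (x := 4)) ?posrE // lnd.
  rewrite (lnXn k) ?divr_gt0 // (lnXn 4) // ln4E -[ln (3 / 2) *+ k]mulr_natl -[_ *+ 4]mulr_natl -/y => low.
  rewrite mulrA ler_pdivrMr //.
  have kl : k%:R * (1 / 3) <= k%:R * ln (3 / 2) :> R by apply: ler_wpM2l.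
  by move: low kl kx ys ln2_1 s_le_x s1000; move: (k%:R * ln _) => z; rewrite -/y -/x; clear; lra.
have up : x ^+ (2 * d) <= 4 ^+ n.
  apply: le_trans (ltW dup) _; rewrite -/x.
  have -> : 4^-1 * x ^- 2 * rho * x ^+ 2 = 4^-1 * rho * (x ^+ 2 / x ^+ 2) by ring.
  rewrite divff ?gt_eqF // mulr1; apply: le_trans (_ : 4 ^+ k <= _).
    apply: le_trans rup; rewrite ler_piMl ?invf_le1 //.
      by apply: le_trans rlow; rewrite exprn_ge0 // divr_ge0.
    by rewrite ler1n.
  by rewrite ler_weXn2l ?leq_subr // ler1n.
have {up} : ln (x ^+ (2 * d)) <= ln (4 ^+ n) by rewrite ler_ln ?posrE ?exprn_gt0.
rewrite lnd lnXn // ln4E -[leRHS]mulr_natl -/x => up.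
rewrite mul1r ler_pdivlMr // -/x -/y.
have : x * (ln 2 + ln 2) <= x * 2 by rewrite ler_wpM2l ?(ltW x0) //; move: ln2_1; clear; lra.
move: up; rewrite -[2 * _ * y]mulrA.
by move: (x * (_ + _)) (d%:R * y) => z w; clear; lra.
Qed.

(** * Explicit constants and the threshold for the size bound *)

Theorem theorem6p1 (R : realType) (eps : R)
    (eps_gt0 : 0 < eps) (eps_lt : eps < 1 / 100) :
  exists (c a b : R) (n0 : nat),
    [/\ 0 < c, 0 < a, 0 < b &
    forall n : nat, (n0 <= n)%N -> prime_power n ->
    forall r k m d D : nat, nw_parameters eps n r k m d D ->
      a * (n%:R / ln n%:R) <= d%:R <= b * (n%:R / ln n%:R)
      /\
      forall (F : fieldType) (K L : finFieldType) (iota : {rmorphism K -> L})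
             (phi : 'I_n -> K) (psi : L -> 'I_(n ^ 2)),
        #|K| = n -> #|L| = (n ^ 2)%N -> bijective phi -> bijective psi ->
      forall C : spsp_circuit F (n * n ^ 2),
        homogeneous_circuit C ->
        circuit_poly C = NW F iota phi psi D ->
        powR n%:R (c * Num.sqrt n%:R) <= (circuit_size C)%:R].
Proof.
(* The summands ensure, in order, [ln n >= 20], [sqrt n >= 1000], [n ^ (eps / 4) >= 32] and
   [eps * sqrt n >= 2]. *)
pose th : R := 2 ^+ 40 + (1000 ^+ 2 + (powR 32 (4 / eps) + (2 / eps) ^+ 2)).
have t1 : 0 <= 2 ^+ 40 :> R by rewrite exprn_ge0.
have t2 : 0 <= 1000 ^+ 2 :> R by rewrite exprn_ge0.
have t3 : 0 <= powR 32 (4 / eps) by apply: powR_ge0.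
have t4 : 0 <= (2 / eps) ^+ 2 by rewrite exprn_ge0 // divr_ge0 // ltW.
exists (eps / 32), (1 / 24), 1, (Num.truncn th).+1; split=> //.
- by rewrite divr_gt0.
- by rewrite divr_gt0.
move=> n n0 _ r' k' m' d D par.
pose x : R := n%:R; pose s := Num.sqrt x; pose y := ln x.
have xth : th <= x.
  apply/ltW/(lt_le_trans (truncnS_gt th)); by rewrite ler_nat.
have x40 : 2 ^+ 40 <= x.
  by apply: le_trans xth; rewrite /th lerDl !addr_ge0.
have xM : 1000 ^+ 2 <= x.
  by apply: le_trans xth; rewrite /th addrCA lerDl !addr_ge0.
have x32 : powR 32 (4 / eps) <= x.
  by apply: le_trans xth; rewrite /th addrA addrCA lerDl !addr_ge0.
have xe : (2 / eps) ^+ 2 <= x.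
  by apply: le_trans xth; rewrite /th !addrA lerDr !addr_ge0.
have drange := d_range xM par; split=> //.
move=> F K L iota phi psi _ cL phib psib C hom CE.
have [_ _ _ _ Dr] := par.
have x0 : 0 < x by apply: lt_le_trans x40; rewrite exprn_gt0.
have x1 : 1 <= x by apply: le_trans xM; rewrite exprn_ege1 // ler1n.
have s2 : s ^+ 2 = x by rewrite /s sqr_sqrtr // ltW.
have s0 : 0 <= s by apply: sqrtr_ge0.
have s1000 : 1000 <= s.
  by rewrite -(ler_pXn2r (n := 2)) ?nnegrE // s2.
have se : 2 <= eps * s.
  have : 2 / eps <= s.
    by rewrite -(ler_pXn2r (n := 2)) ?nnegrE ?divr_ge0 ?(ltW eps_gt0) // s2.
  by rewrite ler_pdivrMr // mulrC.
have y20 : 20 <= y.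
  have : ln (2 ^+ 40) <= y by rewrite ler_ln ?posrE ?exprn_gt0.
  rewrite lnXn // -[leLHS]mulr_natl; have := ln2_ge_half R; rewrite -/y; move: (ln 2) y => u v; clear; lra.
(* The number of low rows in the measure, distinct from the prescribed [r']. *)
pose r := Num.truncn (s / 8).
have /andP[rlow rup] : r%:R <= s / 8 < r.+1%:R.
  by apply: truncn_itv; rewrite divr_ge0.
rewrite -[r.+1%:R]natr1 in rup.
have r24 : (24 <= r)%N by rewrite -(ler_nat R); move: rup s1000; clear; lra.
have r0 : 0 <= r%:R :> R by [].
have r_le : (64 * r ^ 2 <= n)%N.
  rewrite -(ler_nat R) natrM natrX -/x -s2.
  by move: rlow s0 r0; move: (r%:R) => u; clear; nra.
have r_gt : (n < 64 * r.+1 ^ 2)%N.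
  rewrite -(ltr_nat R) natrM natrX -[r.+1%:R]natr1 -/x -s2.
  by move: rup s0 r0; move: (r%:R) => u; clear; nra.
have d0 : 0 <= d%:R :> R by [].
have s_le_x : 1000 * s <= x by rewrite -s2 expr2 ler_wpM2r.
have es_le : 2 * s <= eps * x by rewrite -s2 expr2 mulrA ler_wpM2r.
have dup : d%:R <= x / 20.
  have [_ h] := andP drange; apply: le_trans h _; rewrite mul1r -/x -/y.
  by rewrite ler_pM2l // lef_pV2 ?posrE //; apply: lt_le_trans y20.
have [Dlow Dup] : eps * x / 2 - 1 <= D%:R /\ D%:R <= x / 10.
  move: Dr; rewrite /rounds -/x ltr_norml => /andP[h1 h2]; split.
    by move: h1 d0; move: (eps * x) (d%:R) (D%:R) => u v w; clear; lra.
  have ex : eps * x <= 1 / 100 * x by rewrite ler_wpM2r ?(ltW x0) // ltW.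
  by move: h2 dup ex s_le_x s1000; move: (eps * x) (d%:R) (D%:R) => u v w; clear; lra.
have rD : (r <= D)%N.
  rewrite -(ler_nat R); move: Dlow rlow es_le s1000; move: (eps * x) (D%:R) => u v; clear; lra.
have Dn : (10 * D <= n)%N by rewrite -(ler_nat R) natrM -/x; move: Dup; clear; lra.
pose B : R := powR x (eps / 2).
have B32 : 32 <= powR x (eps / 4).
  have e0 : 0 <= eps / 4 by rewrite divr_ge0 // ltW.
  have := ge0_ler_powR e0 (_ : powR 32 (4 / eps) \in Num.nneg) (_ : x \in Num.nneg) x32.
  rewrite !nnegrE t3 (ltW x0) => /(_ isT isT); rewrite -powRrM.
  have -> : 4 / eps * (eps / 4) = 1 by field; rewrite gt_eqF.
  by rewrite powRr1.
have BE : B = powR x (eps / 4) ^+ 2.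
  by rewrite /B -powR_mulrn ?powR_ge0 // -powRrM; congr (powR _ _); field.
have B1024 : 1024 <= B.
  rewrite BE; apply: (@le_trans _ _ (32 ^+ 2)); first by rewrite expr2 -natrM.
  by apply: lerXn2r; rewrite ?nnegrE ?powR_ge0.
have B1 : 1 <= B by apply: le_trans B1024; rewrite ler1n.
have B0 : 0 < B by apply: lt_le_trans B1.
(* With [B = n ^ (eps / 2)] and [2 <= n ^ (eps / 4)], it remains to see
   [3 * eps * n / 4 <= 2 * (D - r)]; this follows from [2 * D >= eps * n - 2], as [eps * n / 4]
   exceeds [2 * r + 2]. *)
have BD : (2 * B) ^+ (n - r) <= n%:R ^+ (2 * (D - r)).
  apply: (@le_trans _ _ (powR x (3 * eps / 4) ^+ (n - r))).
    apply: lerXn2r; rewrite ?nnegrE ?powR_ge0 ?mulr_ge0 ?(ltW B0) //.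
    have -> : 3 * eps / 4 = eps / 4 + eps / 2 by field.
    rewrite powRD; last by rewrite (gt_eqF x0) implybT.
    rewrite ler_wpM2r ?(ltW B0) //; apply: le_trans B32; by rewrite ler_nat.
  rewrite -!powR_mulrn ?powR_ge0 ?(ltW x0) // -powRrM -/x; apply: ler_powR => //.
  rewrite natrM (natrB _ rD); apply: (@le_trans _ _ (3 * eps / 4 * x)).
    by rewrite ler_wpM2l ?ler_nat ?leq_subr // !mulr_ge0 ?invr_ge0 ?(ltW eps_gt0).
  have -> : 3 * eps / 4 * x = 3 / 4 * (eps * x) by ring.
  by move: Dlow rlow es_le s1000; move: (eps * x) (D%:R) => u v; clear; lra.
set S := (circuit_size C)%:R.
have goal_le : powR x (eps / 32 * s) <= B ^+ r.
  rewrite -powR_mulrn ?(ltW B0) // -powRrM; apply: ler_powR => //.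
  have : s <= 16 * r%:R by move: rup s1000 ; clear; lra.
  move=> h; have : eps * s <= eps * (16 * r%:R) by rewrite ler_wpM2l ?(ltW eps_gt0).
  have -> : eps / 32 * s = eps * s / 32 by ring.
  have -> : eps / 2 * r%:R = eps * (16 * r%:R) / 32 by field.
  by move: (eps * s) (eps * _) => u v; clear; lra.
apply: le_trans goal_le _.
have [h|h] := nw_circuit_lower_bound r24 r_le r_gt rD Dn B1 BD cL phib psib hom CE.
  (* Half of the exponent [2 * r] is spent on the constant 1024. *)
  have Br : 1024 <= B ^+ r.
    by apply: le_trans B1024 _; rewrite -[leLHS]expr1 ler_weXn2l //; move: r24; clear; lia.
  have : 1024 * B ^+ r <= 1024 * S.
    by apply: le_trans h; rewrite mul2n -addnn exprD ler_wpM2r // exprn_ge0 // ltW.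
  by move: (B ^+ r) => u; clear; lra.
(* In the second alternative a size below [B ^ r] is excluded by comparing exponents of [n]:
   [16 * (eps * r / 2 + 3) <= 6 * r], since [eps <= 1 / 100] and [r >= 24]. *)
rewrite leNgt; apply/negP => SB.
have : (S * x ^+ 3) ^+ 16 < (B ^+ r * x ^+ 3) ^+ 16.
  rewrite ltrXn2r // ?nnegrE ?mulr_ge0 ?exprn_ge0 ?(ltW B0) ?(ltW x0) //.
  by rewrite ltr_pM2r // exprn_gt0.
apply/negP; rewrite -leNgt; apply: le_trans h.
have -> : B ^+ r * x ^+ 3 = powR x (eps / 2 * r%:R + 3%:R).
  rewrite powRD; last by rewrite (gt_eqF x0) implybT.
  by rewrite powRrM !powR_mulrn ?powR_ge0 ?(ltW x0).
rewrite -!powR_mulrn ?powR_ge0 ?(ltW x0) // -powRrM -/x; apply: ler_powR => //.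
rewrite natrM.
have : 24 <= r%:R :> R by rewrite ler_nat.
have : eps * r%:R <= 1 / 100 * r%:R by rewrite ler_wpM2r // ltW.
have -> : eps / 2 * r%:R = eps * r%:R / 2 by ring.
by move: (r%:R) (eps * _) => v u; clear; lra.
Qed.
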